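(* Assume Martin's axiom and the negation of the continuum hypothesis (MA+$\neg$CH). Suppose that $\mathcal{A}$ is an almost disjoint family of subsets of $\mathbb{N}$ of cardinality $\kappa<\mathfrak{c}$, where $\kappa$ has uncountable cofinality. Then the Banach space generated in $\ell_\infty$ by $c_0$ and $\{1_A: A\in\mathcal{A}\}$ (i.e. the norm closure in $\ell_\infty$ of the linear span of $c_0\cup\{1_A: A\in\mathcal{A}\}$) does not admit an overcomplete set.
   Context: All Banach spaces are infinite dimensional and over the reals. $dens(X)$ is the minimal cardinality of a norm dense subset of $X$; $\mathfrak{c}=|\mathbb{R}|$. A subset $Y$ of a Banach space $X$ is called overcomplete (in $X$) if $|Y|=dens(X)$ and every $Z\subseteq Y$ with $|Z|=|Y|$ is linearly dense in $X$ (its linear span is norm dense in $X$). $1_A$ is the characteristic function of $A\subseteq\mathbb{N}$. An almost disjoint family consists of infinite subsets of $\mathbb{N}$ whose pairwise intersections are finite. MA: for every partial order with the countable chain condition and every family of fewer than $\mathfrak{c}$ dense subsets there is a filter meeting all of them. *)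

(* Defs.v *)
From HB Require Import structures.
From mathcomp Require Import all_boot all_order all_algebra.
From mathcomp Require Import all_classical all_reals all_analysis.
From mathcomp Require Import wochoice.

Set Implicit Arguments.
Unset Strict Implicit.
Unset Printing Implicit Defensive.

Import Order.TTheory GRing.Theory Num.Theory.
Import numFieldNormedType.Exports.

Local Open Scope classical_set_scope.
Local Open Scope card_scope.
Local Open Scope ring_scope.

Definition card_lt (T U : Type) (A : set T) (B : set U) : Prop :=
  A #<= B /\ ~ (B #<= A).

(* [r] well-orders [A] in type the initial ordinal of [|A|], i.e. the cardinal
   of [A] seen as an ordinal: all proper initial segments are smaller. *)
Definition initial_well_order (T : Type) (A : set T) (r : rel T) : Prop :=
  wo_chain r (mem A) /\
  forall a, A a -> card_lt [set x | [/\ A x, r x a & x <> a]] A.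

Definition cofinal_in (T : Type) (A : set T) (r : rel T) (C : set T) : Prop :=
  C `<=` A /\ forall a, A a -> exists2 c, C c & r a c.

(* The cofinality of the cardinal [|A|], which is the least cardinality of a
   cofinal subset of its initial ordinal, is uncountable. *)
Definition uncountable_cofinality (T : Type) (A : set T) : Prop :=
  exists2 r : rel T, initial_well_order A r &
    forall C, cofinal_in A r C -> ~ countable C.

Definition continuum_hypothesis (R : realType) : Prop :=
  forall S : set R, countable S \/ S #= [set: R].

Section Forcing.
Context (d : Order.disp_t) (P : porderType d).
Local Open Scope order_scope.

Definition compatible (p q : P) : Prop := exists2 r, r <= p & r <= q.

Definition strong_antichain (A : set P) : Prop :=
  forall p q, A p -> A q -> p <> q -> ~ compatible p q.

Definition ccc : Prop := forall A, strong_antichain A -> countable A.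

Definition po_dense (D : set P) : Prop := forall p, exists2 q, D q & q <= p.

Definition po_filter (G : set P) : Prop :=
  [/\ G !=set0,
      forall p q, G p -> p <= q -> G q &
      forall p q, G p -> G q -> exists r, [/\ G r, r <= p & r <= q]].

End Forcing.

(* Filters are nonempty, so the empty order must be excluded. *)
Definition martin_axiom (R : realType) : Prop :=
  forall (d : Order.disp_t) (P : porderType d), [set: P] !=set0 -> ccc P ->
  forall F : set (set P), card_lt F [set: R] ->
    (forall D, F D -> po_dense D) ->
  exists2 G : set P, po_filter G & forall D, F D -> G `&` D !=set0.

Definition almost_disjoint_family (A : set (set nat)) : Prop :=
  (forall B, A B -> infinite_set B) /\
  (forall B C, A B -> A C -> B <> C -> finite_set (B `&` C)).

Section Overcomplete.
Context (R : realType) (V : completeNormedModType R).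
Implicit Types D E S Y Z : set V.

Definition linear_span S : set V :=
  [set x | exists (n : nat) (a : 'I_n -> R) (v : 'I_n -> V),
     (forall i, S (v i)) /\ x = \sum_(i < n) a i *: v i].

(* The Banach space is a closed subspace [E] of [V] with the inherited norm. *)
Definition dense_in E D : Prop := D `<=` E /\ E `<=` closure D.

Definition card_eq_dens E Y : Prop :=
  (exists2 D, dense_in E D & Y #= D) /\
  (forall D, dense_in E D -> Y #<= D).

Definition linearly_dense_in E Z : Prop := dense_in E (linear_span Z).

Definition overcomplete_in E Y : Prop :=
  [/\ Y `<=` E, card_eq_dens E Y &
      forall Z, Z `<=` Y -> Z #= Y -> linearly_dense_in E Z].

End Overcomplete.

Section Linf.
Context (R : realType).

Definition bounded_seq : {pred nat -> R} := mem [set f : nat -> R | bounded_fun f].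

Lemma bounded_seqP (f : nat -> R) :
  f \in bounded_seq <-> exists M, forall n, `|f n| <= M.
Proof.
rewrite /bounded_seq inE /=; split.
  move=> [M [_ hM]]; exists (M + 1) => n.
  by apply: (hM (M + 1)) => //; rewrite ltrDl.
move=> [M hM]; exists M; split; first by rewrite num_real.
by move=> x Mx n _; exact: le_trans (hM n) (ltW Mx).
Qed.

Lemma bounded_seq_submod_closed : submod_closed bounded_seq.
Proof.
split.
  by apply/bounded_seqP; exists 0 => n; rewrite normr0.
move=> a f g /bounded_seqP[M hM] /bounded_seqP[N hN]; apply/bounded_seqP.
exists (`|a| * M + N) => n; apply: le_trans (ler_normD _ _) _.
by apply: lerD (hN n); rewrite normrM ler_wpM2l.
Qed.

HB.instance Definition _ :=
  GRing.isSubmodClosed.Build _ _ bounded_seq bounded_seq_submod_closed.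

Record linf := Linf { linf_fun :> nat -> R; _ : linf_fun \in bounded_seq }.

HB.instance Definition _ := [isSub for linf_fun].
HB.instance Definition _ := [Choice of linf by <:].
HB.instance Definition _ := [SubChoice_isSubLmodule of linf by <:].

Definition linf_norm (f : linf) : R := sup (range (fun n => `|f n|)).

Lemma linf_norm_has_sup (f : linf) : has_sup (range (fun n => `|f n|)).
Proof.
split; first by exists `|f 0%N|; exists 0%N.
have /bounded_seqP[M hM] := valP f.
by exists M => _ [n _ <-].
Qed.

Lemma le_linf_norm (f : linf) n : `|f n| <= linf_norm f.
Proof. by apply: (sup_upper_bound (linf_norm_has_sup f)); exists n. Qed.

Lemma linf_norm_le (f : linf) M : (forall n, `|f n| <= M) -> linf_norm f <= M.
Proof.
move=> hM; apply: ge_sup => [|_ [n _ <-]//].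
by have [] := linf_norm_has_sup f.
Qed.

Lemma linf_normD (f g : linf) : linf_norm (f + g) <= linf_norm f + linf_norm g.
Proof.
apply: linf_norm_le => n; apply: le_trans (ler_normD _ _) _.
by apply: lerD; exact: le_linf_norm.
Qed.

Lemma linf_normZ (a : R) (f : linf) : linf_norm (a *: f) = `|a| * linf_norm f.
Proof.
apply/eqP; rewrite eq_le; apply/andP; split.
  by apply: linf_norm_le => n; rewrite normrM ler_wpM2l // le_linf_norm.
have [->|a0] := eqVneq a 0.
  by rewrite normr0 mul0r; apply: le_trans (le_linf_norm _ 0%N).
rewrite -ler_pdivlMl ?normr_gt0//; apply: linf_norm_le => n.
rewrite ler_pdivlMl ?normr_gt0// -normrM.
exact: le_linf_norm (a *: f) n.
Qed.

Lemma linf_norm0_eq0 (f : linf) : linf_norm f = 0 -> f = 0.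
Proof.
move=> f0; apply/val_inj/funext => n; apply/normr0_eq0/eqP.
by rewrite eq_le normr_ge0 andbT -f0 le_linf_norm.
Qed.

HB.instance Definition _ :=
  Lmodule_isNormed.Build R linf linf_normD linf_normZ linf_norm0_eq0.

Lemma linf_normE (f : linf) : `|f| = sup (range (fun n => `|f n|)).
Proof. by []. Qed.

Lemma linf_cauchy_cvg (F : set_system linf) :
  ProperFilter F -> cauchy F -> cvg F.
Proof.
move=> FF /cauchyP Fc.
have Fe e : 0 < e -> exists f : linf, \forall g \near F, `|f - g| < e.
  by move=> e0; have [f] := Fc e e0; rewrite -ball_normE; exists f.
have near_le (f g : linf) n e : `|f - g| < e -> `|f n - g n| < e.
  by apply: le_lt_trans; exact: (le_linf_norm (f - g) n).
have Fn n : cvg ((fun f : linf => f n) @ F).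
  apply/cauchy_cvgP/cauchyP => e e0; have [f hf] := Fe _ e0; exists (f n).
  by apply: filterS hf => g /near_le; rewrite -ball_normE; exact.
pose l n := lim ((fun f : linf => f n) @ F).
have ln (f : linf) e : (\forall g \near F, `|f - g| < e) ->
    forall n, `|f n - l n| <= e.
  move=> hf n.
  have : (fun g : linf => `|f n - g n|) @ F --> `|f n - l n|.
    by apply: cvg_norm; apply: cvgB; [exact: cvg_cst|exact: Fn].
  move=> /cvgr_to_le; apply; apply: filterS hf => g /(near_le _ _ n).
  exact: ltW.
have lP : l \in bounded_seq.
  have [f /ln hf] := Fe _ ltr01.
  apply/bounded_seqP; exists (1 + linf_norm f) => n.
  rewrite -[l n](subrK (f n)); apply: le_trans (ler_normD _ _) _.
  by rewrite lerD ?le_linf_norm// distrC.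
apply/cvg_ex; exists (Linf lP); apply/cvgrPdist_le => /= e e0.
have e20 : 0 < e / 2 by rewrite divr_gt0.
have [f hf] := Fe _ e20; apply: filterS (hf) => g fg.
apply: linf_norm_le => n; change (`|l n - g n| <= e).
have -> : l n - g n = (l n - f n) + (f n - g n) by rewrite addrA subrK.
rewrite (splitr e); apply: le_trans (ler_normD _ _) _; apply: lerD.
  by rewrite distrC; exact: ln.
exact/ltW/near_le.
Qed.

HB.instance Definition _ := Uniform_isComplete.Build linf linf_cauchy_cvg.

Definition c0 : set linf := [set f : linf | f n @[n --> \oo] --> (0 : R)].

Lemma indic_bounded_seq (B : set nat) : (\1_B : nat -> R) \in bounded_seq.
Proof.
apply/bounded_seqP; exists 1 => n; rewrite indicE.
by case: (n \in B); rewrite ?normr1 ?normr0.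
Qed.

Definition linf_indic (B : set nat) : linf := Linf (indic_bounded_seq B).

Definition generated_space (A : set (set nat)) : set linf :=
  closure (linear_span (c0 `|` linf_indic @` A)).

End Linf.

Arguments generated_space R A : clear implicits.

(* Main.v *)
(** Let [x] be the first unit vector and suppose that [Y] is overcomplete.  An
    element of the generated space tends to [0] along all but countably many
    members of [A], so fewer than [|A|] vectors never span; transfinite
    recursion thus gives [g : A -> Y] with [g a] outside the closed span of [x]
    and the earlier values.  Passing to a set [I] of [|A|] many indices, the
    distances are at least [d > 0] and the norms are bounded.

    Finitely many vectors that are [d]-separated in this triangular sense can be
    interpolated by a finitely supported functional on [N], with a bound in
    [l_1] that depends only on their number.  Consider the finite sets
    [p] of indices for which some finitely supported [m] satisfies
    [|m|_1 < L], [m(x) = 1] and [m(g a) = 0] for [a] in [p].  If the functionals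
    of [p] and [q] have a common sufficiently close rational approximation, then
    the functional of [p] is small on [g a] for [a] in [q], and a small
    interpolating correction yields a functional for the union.  Hence this
    family is sigma-linked, and its finite-support countable power is ccc.
    Martin's axiom covers [I] by countably many sets [Z n] all of whose finite
    subsets belong to the family.  By uncountable cofinality one [Z n] has [|A|]
    elements, but [x] has distance at least [1 / L] from the span of
    [g @` Z n]. *)

Require Import Defs.
From HB Require Import structures.
From mathcomp Require Import all_boot all_order all_algebra finmap.
From mathcomp Require Import all_classical all_reals all_analysis.
From mathcomp Require Import wochoice.

Set Implicit Arguments.
Unset Strict Implicit.
Unset Printing Implicit Defensive.

Import Order.TTheory GRing.Theory Num.Theory.
Import numFieldNormedType.Exports.

Local Open Scope classical_set_scope.
Local Open Scope card_scope.
Local Open Scope ring_scope.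

(** * Cardinality of finite sequences *)

Definition partial_inj (T U : Type) (G : set (T * U)) : Prop :=
  forall t u t' u', G (t, u) -> G (t', u') -> (t = t') <-> (u = u').

Lemma partial_inj_bigcup (T U : Type) (F : set (set (T * U))) :
  total_on F subset -> (forall G, F G -> partial_inj G) ->
  partial_inj (\bigcup_(G in F) G).
Proof.
move=> Ftot Finj t u t' u' [G FG Gtu] [G' FG' Gtu'].
have [GG'|G'G] := Ftot _ _ FG FG'.
  exact: Finj FG' _ _ _ _ (GG' _ Gtu) Gtu'.
exact: Finj FG _ _ _ _ Gtu (G'G _ Gtu').
Qed.

Lemma card_le_rel (T U : Type) (A : set T) (B : set U) (G : T -> U -> Prop) :
  (forall t, A t -> exists2 u, B u & G t u) ->
  (forall t t' u, A t -> A t' -> G t u -> G t' u -> t = t') -> A #<= B.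
Proof.
elim/Ppointed: U => U in B G *.
  move=> AB _; suff -> : A = set0 by [].
  apply/seteqP; split=> // t /AB[u]; by have := no u.
move=> AB Ginj.
have /choice[f fP] : forall t, exists u, A t -> B u /\ G t u.
  move=> t; have [At|] := pselect (A t); last by exists point.
  by have [u Bu Gu] := AB _ At; exists u.
apply/pcard_leP/injfunPex; exists f => [t /fP[]//|t t'].
rewrite !inE => At At' ftt'.
apply: (Ginj _ _ (f t)) => //; first by have [] := fP _ At.
by rewrite ftt'; have [] := fP _ At'.
Qed.

Lemma card_le_inj (T U : Type) (A : set T) (B : set U) (f : T -> U) :
  (forall t, A t -> B (f t)) ->
  (forall t t', A t -> A t' -> f t = f t' -> t = t') -> A #<= B.
Proof.
move=> fAB finj; apply: (@card_le_rel _ _ _ _ (fun t u => f t = u)).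
  by move=> t /fAB; exists (f t).
by move=> t t' u At At' <- /esym; exact: finj.
Qed.

Lemma card_le_injP (T : Type) (U : pointedType) (A : set T) (B : set U) :
  A #<= B -> exists2 f : T -> U, (forall t, A t -> B (f t)) &
    forall t t', A t -> A t' -> f t = f t' -> t = t'.
Proof.
move=> /pcard_leP/injfunPex[f fAB finj]; exists f => // t t' At At'.
by apply: finj; rewrite inE.
Qed.

(** A maximal partial injection between [A] and [B], given by Zorn's lemma, exhausts one of the two
    sets, since otherwise one more pair could be added. *)
Lemma card_le_total (T U : Type) (A : set T) (B : set U) :
  A #<= B \/ B #<= A.
Proof.
pose P := [set G : set (T * U) | partial_inj G /\ G `<=` A `*` B].
have [F FP Ftot|G [[Ginj GAB] Gmax]] := @Zorn_bigcup _ P.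
  split; first by apply: partial_inj_bigcup => // G /FP[].
  by move=> z [G /FP[_ GAB] /GAB].
have [domG|/existsNP[a /not_implyP[Aa naG]]] :=
    pselect (forall a, A a -> exists b, G (a, b)).
  left; apply: (@card_le_rel _ _ _ _ (fun a b => G (a, b))) => [a /domG[b Gab]|].
    by exists b => //; have [] := GAB _ Gab.
  by move=> a a' b _ _ Gab Ga'b; apply/(Ginj _ _ _ _ Gab Ga'b).
have [ranG|/existsNP[b /not_implyP[Bb nbG]]] :=
    pselect (forall b, B b -> exists a, G (a, b)).
  right; apply: (@card_le_rel _ _ _ _ (fun b a => G (a, b))) => [b /ranG[a0 Gab]|].
    by exists a0 => //; have [] := GAB _ Gab.
  by move=> b0 b1 a0 _ _ Gab Gab1; apply/(Ginj _ _ _ _ Gab Gab1).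
exfalso; apply: (Gmax ((a, b) |` G)).
  split; first by move=> z; right.
  by move=> sub; apply: naG; exists b; apply: sub; left.
split; last by move=> z [->|/GAB].
move=> t u t' u' [[-> ->]|Gtu] [[-> ->]|Gtu'] //; last exact: Ginj Gtu Gtu'.
- split=> [ta|ub]; first by case: naG; exists u'; rewrite ta.
  by case: nbG; exists t'; rewrite ub.
- split=> [ta|ub]; first by case: naG; exists u; rewrite -ta.
  by case: nbG; exists t; rewrite -ub.
Qed.

Section SeqCard.
Context (T : pointedType).
Implicit Types (B C D : set T) (s : seq T) (G : set (seq T * T)).

Definition seqs_in C : set (seq T) := [set s | [set` s] `<=` C].

Lemma seqs_in_cons C t s : seqs_in C (t :: s) <-> C t /\ seqs_in C s.
Proof.
split=> [Cs|[Ct Cs] u /=].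
  by split=> [|u us]; apply: Cs; rewrite /= inE ?eqxx// us orbT.
by rewrite inE => /orP[/eqP->//|/Cs].
Qed.

Lemma seqs_in_map C D (e : T -> T) s : (forall t, C t -> D (e t)) ->
  seqs_in C s -> seqs_in D (map e s).
Proof. by move=> eCD Cs _ /mapP[t /Cs Ct ->]; exact: eCD. Qed.

Lemma map_seqs_inj (U V : eqType) (E : set U) (e : U -> V) (s s' : seq U) :
  (forall t t', E t -> E t' -> e t = e t' -> t = t') ->
  [set` s] `<=` E -> [set` s'] `<=` E -> map e s = map e s' -> s = s'.
Proof.
move=> einj; elim: s s' => [|t s IH] [|t' s']//= Es Es' [ett' ess'].
have mem_head (u : U) r : u \in u :: r by rewrite inE eqxx.
congr cons; first by apply: einj => //; [apply: Es|apply: Es'] => /=; exact: mem_head.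
by apply: IH => // u us; [apply: Es|apply: Es']; rewrite /= inE us orbT.
Qed.

(** The carrier of a coding is read off its graph from the one-term sequences, so that Zorn's lemma
    can be applied to graphs alone. *)
Definition coded G : set T := [set t | exists u, G ([:: t], u)].

(* The empty sequence is left out so that the empty graph is a coding. *)
Definition seq_coding B G : Prop :=
  [/\ partial_inj G, coded G `<=` B, G `<=` [set z | coded G z.2] &
      forall s, (exists u, G (s, u)) <-> s <> [::] /\ seqs_in (coded G) s].

Lemma seq_coding_bigcup B (F : set (set (seq T * T))) :
  total_on F subset -> (forall G, F G -> seq_coding B G) ->
  seq_coding B (\bigcup_(G in F) G).
Proof.
move=> Ftot Fcod.
have sub G : F G -> coded G `<=` coded (\bigcup_(G in F) G).
  by move=> FG t [u Gtu]; exists u, G.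
split.
- by apply: partial_inj_bigcup => // G /Fcod[].
- by move=> t [u [G FG Gtu]]; have [_ + _ _] := Fcod _ FG; apply; exists u.
- by move=> z [G FG Gz]; apply: (sub _ FG); have [_ _ + _] := Fcod _ FG; apply.
move=> s; split=> [[u [G FG Gsu]]|[]].
  have [_ _ _ /(_ s)[+ _]] := Fcod _ FG => -[]; first by exists u.
  by move=> s0 sG; split=> // t /sG/sub; exact.
case: s => // t s _ Cs.
(* The sequence is finite and [F] is a chain, so a single graph has all the entries in its
   carrier. *)
have [G FG sG] : exists2 G, F G & seqs_in (coded G) (t :: s).
  elim: s t Cs => [|t' s IH] t /seqs_in_cons[[u [G FG Gtu]]].
    by move=> _; exists G => //; apply/seqs_in_cons; split=> //; exists u.
  move=> /IH[G' FG' G's].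
  have [GG'|G'G] := Ftot _ _ FG FG'.
    exists G' => //; apply/seqs_in_cons; split=> //; exists u; exact: GG'.
  exists G => //; apply/seqs_in_cons; split; first by exists u.
  by move=> w /G's[v G'v]; exists v; exact: G'G.
have [_ _ _ /(_ (t :: s))[_ +]] := Fcod _ FG => -[//|u Gu].
by exists u, G.
Qed.

Lemma seq_coding_extend B G D (h : seq T -> T) : seq_coding B G ->
  D `<=` B `\` coded G -> D !=set0 ->
  (forall s, seqs_in (coded G `|` D) s -> D (h s)) ->
  (forall s s', seqs_in (coded G `|` D) s -> seqs_in (coded G `|` D) s' ->
     h s = h s' -> s = s') ->
  exists2 G', seq_coding B G' & G `<` G'.
Proof.
move=> [Ginj CB Gran Gdom] DB [d Dd] hD hinj.
set C := coded G in CB Gran Gdom DB hD hinj *.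
(* Sequences over the old carrier keep their codes; all others get codes in [D], which is disjoint
   from the carrier, so no two codes collide. *)
pose G' := G `|` [set z | [/\ z.1 <> [::], seqs_in (C `|` D) z.1,
  ~ seqs_in C z.1 & z.2 = h z.1]].
have nCD t : D t -> ~ C t by move=> /DB[].
have cG' : coded G' = C `|` D.
  apply/seteqP; split=> t.
    move=> [u [Gtu|[_ /= /seqs_in_cons[//]]]]; by left; exists u.
  move=> [[u Gu]|Dt]; first by exists u; left.
  exists (h [:: t]); right; split=> //.
    by apply/seqs_in_cons; split=> //; right.
  by move=> /= /seqs_in_cons[/nCD].
have dG' s u : G (s, u) -> seqs_in C s.
  by move=> Gs; have [_] := (Gdom s).1 (ex_intro _ u Gs).
exists G'; last first.
  split; first by move=> z; left.
  move=> /(_ ([:: d], h [:: d])) sub.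
  have : G ([:: d], h [:: d]).
    apply: sub; right; split=> //; first by apply/seqs_in_cons; split=> //; right.
    by move=> /= /seqs_in_cons[/nCD].
  by move=> /dG'/seqs_in_cons[/(nCD _ Dd)].
split; rewrite ?cG'.
- move=> s u s' u' [Gsu|[_ /= sCD snC ->]] [Gsu'|[_ /= sCD' snC' ->]].
  + exact: Ginj.
  + split=> [ss'|uh]; first by case: snC'; rewrite -ss'; exact: dG' Gsu.
    by case: (nCD _ (hD _ sCD')); rewrite -uh; exact: Gran Gsu.
  + split=> [ss'|uh]; first by case: snC; rewrite ss'; exact: dG' Gsu'.
    by case: (nCD _ (hD _ sCD)); rewrite uh; exact: Gran Gsu'.
  + by split=> [->//|]; exact: hinj.
- by move=> t [/CB//|/DB[]].
- move=> [s u] [/Gran|[_ /= sCD _ ->]]; first by left.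
  by right; exact: hD.
move=> s; split=> [[u [Gsu|[]//]]|[s0 sCD]].
  have [s0 sC] := (Gdom s).1 (ex_intro _ u Gsu).
  by split=> // t /sC; left.
have [sC|snC] := pselect (seqs_in C s).
  have [u Gu] := (Gdom s).2 (conj s0 sC).
  by exists u; left.
by exists (h s); right.
Qed.

Lemma seq_coding_fun B G : seq_coding B G -> exists f : seq T -> T,
  (forall t s, seqs_in (coded G) (t :: s) -> coded G (f (t :: s))) /\
  (forall t s t' s', seqs_in (coded G) (t :: s) -> seqs_in (coded G) (t' :: s') ->
    f (t :: s) = f (t' :: s') -> t :: s = t' :: s').
Proof.
move=> [Ginj _ Gran Gdom].
have /choice[f fP] : forall s, exists u,
    s <> [::] -> seqs_in (coded G) s -> G (s, u).
  move=> s; have [sP|nP] := pselect (s <> [::] /\ seqs_in (coded G) s).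
    by have [u Gu] := (Gdom s).2 sP; exists u.
  by exists point => s0 sG; case: nP.
exists f; split=> [t s sG|t s t' s' sG sG' ff].
  by apply: Gran (t :: s, f (t :: s)) _; exact: fP.
by apply/(Ginj _ _ _ _ (fP _ _ sG) (fP _ _ sG')).
Qed.

Lemma seq_code_union C E (f : seq T -> T) (psi : T -> T) :
  (forall t s, seqs_in C (t :: s) -> C (f (t :: s))) ->
  (forall t s t' s', seqs_in C (t :: s) -> seqs_in C (t' :: s') ->
    f (t :: s) = f (t' :: s') -> t :: s = t' :: s') ->
  (forall t, E t -> ~ C t -> C (psi t)) ->
  (forall t t', E t -> ~ C t -> E t' -> ~ C t' -> psi t = psi t' -> t = t') ->
  C !=set0 ->
  exists h : seq T -> T, (forall s, seqs_in E s -> C (h s)) /\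
    (forall s s', seqs_in E s -> seqs_in E s' -> h s = h s' -> s = s').
Proof.
move=> fC finj psiC psi_inj [c Cc].
(* Sequences of length one and two have distinct codes, so [e] renames the elements of [E]
   injectively within [C]. *)
pose e t := if pselect (C t) then f [:: t] else f [:: psi t; psi t].
have C1 t : C t -> seqs_in C [:: t] by move=> Ct; apply/seqs_in_cons.
have C2 t : C t -> seqs_in C [:: t; t].
  by move=> Ct; apply/seqs_in_cons; split=> //; exact: C1.
have eC t : E t -> C (e t).
  move=> Et; rewrite /e; case: pselect => Ct; first exact/fC/C1.
  by apply/fC/C2/psiC.
have einj t t' : E t -> E t' -> e t = e t' -> t = t'.
  move=> Et Et'; rewrite /e.
  case: pselect => Ct; case: pselect => Ct'.
  - by move=> /(finj _ _ _ _ (C1 _ Ct) (C1 _ Ct'))[].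
  - by move=> /(finj _ _ _ _ (C1 _ Ct) (C2 _ (psiC _ Et' Ct'))).
  - by move=> /(finj _ _ _ _ (C2 _ (psiC _ Et Ct)) (C1 _ Ct')).
  - move=> /(finj _ _ _ _ (C2 _ (psiC _ Et Ct)) (C2 _ (psiC _ Et' Ct')))[].
    by move=> /psi_inj ->.
(* The leading [c] keeps the sequence nonempty, as [f] is controlled only on nonempty sequences. *)
have cC s : seqs_in E s -> seqs_in C (c :: map e s).
  by move=> Es; apply/seqs_in_cons; split=> //; exact: seqs_in_map Es.
exists (fun s => f (c :: map e s)); split=> [s /cC/fC//|s s' Es Es'].
move=> /(finj _ _ _ _ (cC _ Es) (cC _ Es'))[].
exact: map_seqs_inj einj Es Es'.
Qed.

(** The carrier of a maximal coding cannot embed in its complement, for the coding could then be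
    enlarged. So the complement embeds in the carrier, and [seq_code_union] codes all sequences over
    [B]. *)
Theorem infinite_card_seq B : infinite_set B -> seqs_in B #<= B.
Proof.
move=> /infiniteP/card_le_injP[io ioB io_inj].
have {}io_inj : injective io by move=> m n; exact: io_inj.
have [F FP Ftot|G [GB Gmax]] := @Zorn_bigcup _ [set G | seq_coding B G].
  by apply: seq_coding_bigcup => // G /FP.
have noext D h : D `<=` B `\` coded G -> D !=set0 ->
    (forall s, seqs_in (coded G `|` D) s -> D (h s)) ->
    (forall s s', seqs_in (coded G `|` D) s -> seqs_in (coded G `|` D) s' ->
     h s = h s' -> s = s') -> False.
  move=> DB D0 hD hinj.
  by have [G' G'B GG'] := seq_coding_extend GB DB D0 hD hinj; exact: Gmax GG' G'B.
(* An empty carrier could be enlarged by the range of [io], where sequences are coded through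
   natural numbers. *)
have [C0|/set0P C0] := eqVneq (coded G) set0.
  exfalso.
  have /choice[oi oiP] : forall t, exists n, forall m, io m = t -> n = m.
    move=> t; have [[n <-]|nt] := pselect (exists n, io n = t).
      by exists n => m /io_inj.
    by exists 0%N => m mt; case: nt; exists m.
  have oiK n : oi (io n) = n by exact: oiP.
  apply: (noext (range io) (fun s => io (choice.pickle (map oi s)))).
  - by rewrite C0 setD0 => _ [n _ <-]; exact: ioB.
  - by exists (io 0%N), 0%N.
  - by move=> s _; eexists.
  rewrite C0 set0U => s s' Es Es' /io_inj/(pcan_inj choice.pickleK).
  apply: map_seqs_inj Es Es' => _ _ [m _ <-] [n _ <-].
  by rewrite !oiK => ->.
have [f [fC finj]] := seq_coding_fun GB.
have [CB|BC] := card_le_total (coded G) (B `\` coded G).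
  exfalso; have [phi phiB phi_inj] := card_le_injP CB.
  have /choice[psi psiP] : forall t, exists c,
      (phi @` coded G) t -> coded G c /\ phi c = t.
    move=> t; have [[c Cc <-]|nt] := pselect ((phi @` coded G) t).
      by exists c.
    by exists point.
  have phiN t : (phi @` coded G) t -> ~ coded G t by move=> [c /phiB[_ ?] <-].
  (* Sequences over the enlarged carrier are coded in the old one by [h]; composing with [phi] moves
     these codes to the new half. *)
  have [||h [hC hinj]] := @seq_code_union (coded G) (coded G `|` phi @` coded G) f psi fC finj _ _ C0.
  - by move=> t [//|/psiP[]].
  - move=> t t' [//|/psiP[_ tE]] _ [//|/psiP[_ t'E]] _ tt'.
    by rewrite -tE tt' t'E.
  apply: (noext (phi @` coded G) (phi \o h)).
  - by move=> _ [c /phiB ? <-].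
  - by have [c Cc] := C0; exists (phi c), c.
  - by move=> s /hC ?; exists (h s).
  by move=> s s' Es Es' /phi_inj hh; apply: hinj => //; apply: hh; exact: hC.
have [psi psiC psi_inj] := card_le_injP BC.
have [||h [hC hinj]] := @seq_code_union (coded G) B f psi fC finj _ _ C0.
- by move=> t Bt Ct; exact: psiC.
- by move=> t t' Bt Ct Bt' Ct'; exact: psi_inj.
have [_ CB _ _] := GB.
by apply: (@card_le_inj _ _ _ _ h) => // s /hC/CB.
Qed.

End SeqCard.

(** * Well-orders and uncountable cofinality *)

Section InfiniteAbsorption.
Context (T : pointedType) (B : set T) (Binf : infinite_set B).

Lemma countable_card_le (U : Type) (X : set U) : countable X -> X #<= B.
Proof. by move=> cX; apply: card_le_trans cX _; apply/infiniteP. Qed.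

(** A pair becomes a sequence of length two over [B]. *)
Lemma setX_card_le (U V : Type) (X : set U) (Y : set V) :
  X #<= B -> Y #<= B -> X `*` Y #<= B.
Proof.
move=> /card_le_injP[f fB finj] /card_le_injP[g gB ginj].
apply: card_le_trans (infinite_card_seq Binf).
apply: (@card_le_inj _ _ _ _ (fun z => [:: f z.1; g z.2])) => [z [Xz Yz]|].
  by apply/seqs_in_cons; split; [exact: fB|apply/seqs_in_cons; split=> //; exact: gB].
move=> [x y] [x' y'] [/= Xx Yy] [/= Xx' Yy'] [fxx' gyy'].
by rewrite (finj _ _ Xx Xx' fxx') (ginj _ _ Yy Yy' gyy').
Qed.

Lemma bigcup_card_le (I U : Type) (D : set I) (X : I -> set U) : D #<= B ->
  (forall i, D i -> X i #<= B) -> \bigcup_(i in D) X i #<= B.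
Proof.
move=> DB XB; apply: card_le_trans (setX_card_le DB (card_lexx B)).
have /choice[f fP] : forall i, exists f : U -> T, D i ->
    (forall u, X i u -> B (f u)) /\
    (forall u u', X i u -> X i u' -> f u = f u' -> u = u').
  move=> i; have [Di|] := pselect (D i); last by exists (fun=> point).
  by have [f] := card_le_injP (XB _ Di); exists f.
apply: (@card_le_rel _ _ _ _ (fun u z => [/\ D z.1, X z.1 u & z.2 = f z.1 u])).
  move=> u [i Di Xiu]; exists (i, f i u) => //; split=> //=.
  by have [+ _] := fP _ Di; exact.
move=> u u' [i t] _ _ [/= Di Xu ->] [_ Xu' ff'].
by have [_ +] := fP _ Di; exact.
Qed.

Lemma seqs_card_le (U : eqType) (X : set U) : X #<= B ->
  [set s : seq U | [set` s] `<=` X] #<= B.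
Proof.
move=> /card_le_injP[f fB finj].
apply: card_le_trans (infinite_card_seq Binf).
apply: (@card_le_inj _ _ _ _ (map f)) => [s Xs _ /mapP[u /Xs Xu ->]|s s' Xs Xs'].
  exact: fB.
exact: map_seqs_inj finj Xs Xs'.
Qed.

End InfiniteAbsorption.

Section WellOrder.
Context (T : eqType) (A : set T) (r : rel T) (Awo : wo_chain r (mem A)).

Definition init_seg a := [set x | [/\ A x, r x a & x <> a]].

Lemma wo_min (S : set T) : S `<=` A -> S !=set0 ->
  exists2 m, S m & forall x, S x -> r m x.
Proof.
move=> SA [x Sx]; have [||m [[Sm mS] _]] := @Awo (mem S).
- by move=> y /=; rewrite !inE => /SA.
- by exists x; apply/mem_set.
by exists m => [|y Sy]; [exact: set_mem|apply: mS; exact: mem_set].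
Qed.

Lemma wo_total a b : A a -> A b -> r a b \/ r b a.
Proof.
move=> Aa Ab; have [||m mab mP] := @wo_min [set a; b].
- by move=> _ [->|->].
- by exists a; left.
by case: mab => mE; rewrite -mE; [left|right]; apply: mP; [right|left].
Qed.

Lemma wo_refl a : A a -> r a a.
Proof. by move=> Aa; have [] := wo_total Aa Aa. Qed.

Lemma wo_anti a b : A a -> A b -> r a b -> r b a -> a = b.
Proof.
move=> Aa Ab rab rba; apply: (wo_chain_antisymmetric Awo); rewrite ?inE//.
by rewrite rab.
Qed.

(** The least of the three points, together with antisymmetry, decides every case. *)
Lemma wo_trans a b c : A a -> A b -> A c -> r a b -> r b c -> r a c.
Proof.
move=> Aa Ab Ac rab rbc; have [||m mabc mP] := @wo_min [set a; b; c].
- by move=> _ [[->|->]|->].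
- by exists a; left; left.
have [ma mb mc] : [/\ r m a, r m b & r m c].
  by split; apply: mP; [left; left|left; right|right].
case: mabc => [[mE|mE]|mE]; rewrite -?mE//.
- by rewrite (wo_anti Aa Ab rab) // -mE.
- have cb : c = b by apply: wo_anti => //; rewrite -mE.
  by rewrite mE cb.
Qed.

Lemma wo_rec (U : Type) (step : T -> set U -> U) :
  exists g : T -> U, forall a, A a -> g a = step a (g @` init_seg a).
Proof.
(* Elements outside [A] have no predecessors under [R] and so are accessible. *)
pose R x y := A y /\ init_seg y x.
have Rwf : well_founded R.
  move=> y; apply: contrapT => nAcc.
  have [||m [Am nAm] mP] := @wo_min [set x | A x /\ ~ Acc R x].
  - by move=> x [].
  - by exists y; split=> //; apply: contrapT => nAy; apply: nAcc; constructor=> x [].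
  apply: nAm; constructor=> x [_ [Ax rxm xm]]; apply: contrapT => nAx.
  by apply: xm; apply: wo_anti => //; apply: mP.
pose F a (rec : forall x, R x a -> U) : U :=
  step a [set u | exists x (h : R x a), u = rec x h].
exists (Fix Rwf (fun=> U) F) => a Aa; rewrite Fix_eq; last first.
  move=> x f f' ff'; congr step; apply/seteqP; split=> u [z [h ->]];
  by exists z, h; rewrite ff'.
congr step; apply/seteqP; split=> [u [x [[_ Ix] ->]]|u [x Ix <-]].
  by exists x.
by exists x; have h : R x a by []; exists h.
Qed.

(** Elements of [B] are picked along [A] without repetition. If this never stops, [A] embeds in [B];
    if it stops at [a], the values before [a] exhaust [B]. *)
Lemma init_seg_embed (U : pointedType) (B : set U) : ~ (A #<= B) ->
  exists2 a, A a & B #<= init_seg a.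
Proof.
move=> nAB.
have [g gE] := wo_rec (fun _ S => xget point (B `\` S)).
have [all0|/existsNP[a /not_implyP[Aa]]] :=
    pselect (forall a, A a -> B `\` g @` init_seg a !=set0).
  have gP a : A a -> (B `\` g @` init_seg a) (g a).
    by move=> Aa; rewrite gE//; have [u] := all0 _ Aa; exact: xgetI.
  case: nAB; apply: (@card_le_inj _ _ _ _ g) => [a /gP[]//|a b Aa Ab gab].
  have [|rab] := pselect (r a b).
    apply: contraPP => ab rab; have [_] := gP _ Ab; apply.
    by exists a.
  have rba : r b a by case: (wo_total Aa Ab).
  apply: contrapT => ab; have [_] := gP _ Aa; apply; exists b => //.
  by split=> // /esym.
move=> /set0P/negP; rewrite negbK => /eqP B0; exists a => //.
apply: card_le_trans (card_image_le g _); apply: subset_card_le.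
by move=> u Bu; apply: contrapT => nu; rewrite -[False]/(set0 u) -B0.
Qed.

End WellOrder.

Section UncountableCofinality.
Context (T : pointedType) (A : set T).

(** [A] is cofinal in itself. *)
Lemma uncountable_cofinality_uncountable :
  uncountable_cofinality A -> ~ countable A.
Proof.
move=> [r [Awo _] cof]; apply: cof; split=> // a Aa; exists a => //.
exact: wo_refl Awo _ Aa.
Qed.

Lemma uncountable_infinite : ~ countable A -> infinite_set A.
Proof. by apply: contra_not => /finite_set_countable. Qed.

(** If every fibre were smaller than [A], each would embed in a proper initial segment. The
    countably many endpoints are not cofinal, so all fibres would embed in one segment, which is too
    small to absorb [A]. *)
Lemma uncountable_cofinality_fibre (h : T -> nat) : uncountable_cofinality A ->
  exists n, A #<= [set a | A a /\ h a = n].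
Proof.
move=> Acof; have nA := uncountable_cofinality_uncountable Acof.
case: Acof => r [Awo Ainit] cof.
apply: contrapT => /forallNP nfib.
have /choice[c cP] : forall n, exists a, A a /\
    [set a | A a /\ h a = n] #<= init_seg A r a.
  by move=> n; have [a Aa ?] := init_seg_embed Awo (nfib n); exists a.
have [a Aa na] : exists2 a, A a & forall n, ~ r a (c n).
  apply: contrapT => none; apply: (cof (range c)); last exact: card_image_le.
  split=> [_ [n _ <-]|a Aa]; first by have [] := cP n.
  apply: contrapT => nr; apply: none; exists a => // n rac; apply: nr.
  by exists (c n) => //; exists n.
have fibP n : [set a | A a /\ h a = n] #<= init_seg A r a.
  have [Ac] := cP n; move/card_le_trans; apply; apply: subset_card_le => x [Ax rx xc].
  have rca : r (c n) a by case: (wo_total Awo Ac Aa) => // /na.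
  split=> //; first exact: (wo_trans Awo Ax Ac Aa).
  by move=> xa; apply: (na n); rewrite -xa.
have AE : A `<=` \bigcup_n [set a | A a /\ h a = n].
  by move=> x Ax; exists (h x).
(* Absorbing a countable union requires an infinite segment; with a finite one, [A] would be
   countable. *)
have [Ifin|Iinf] := pselect (finite_set (init_seg A r a)).
  apply: nA; apply: sub_countable (subset_card_le AE) _.
  apply: bigcup_countable => // n _.
  exact: sub_countable (fibP n) (finite_set_countable Ifin).
have [_] := Ainit _ Aa; apply; apply: card_le_trans (subset_card_le AE) _.
by apply: bigcup_card_le => //; exact: countable_card_le.
Qed.

Lemma uncountable_cofinality_cover (U : Type) (B : set U) (Z : nat -> set U) :
  uncountable_cofinality A -> A #<= B -> B `<=` \bigcup_n Z n ->
  exists n, A #<= B `&` Z n.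
Proof.
elim/Ppointed: U => U in B Z *.
  move=> /uncountable_cofinality_uncountable nA AB _; case: nA.
  by apply: sub_countable AB _; rewrite empty_eq0; exact: countable0.
move=> Acof /card_le_injP[f fB finj] BZ.
have /choice[h hP] : forall a, exists n, A a -> Z n (f a).
  move=> a; have [/fB/BZ[n _ Zn]|] := pselect (A a); first by exists n.
  by exists 0%N.
have [n An] := uncountable_cofinality_fibre h Acof; exists n.
apply: card_le_trans An _; apply: (@card_le_inj _ _ _ _ f) => [a [Aa <-]|].
  by split; [exact: fB|exact: hP].
by move=> a a' [Aa _] [Aa' _]; exact: finj.
Qed.

End UncountableCofinality.

(** * Martin's axiom for sigma-linked families *)

Section FinitePower.
Context (T : choiceType) (K : {fset T} -> Prop).
Local Open Scope fset_scope.

(** A condition of the finite-support power is one finite set of pairs; its slices are the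
    coordinates, all but finitely many of them empty. *)
Definition slice (H : {fset nat * T}) (n : nat) : {fset T} :=
  [fset z.2 | z in [fset z in H | z.1 == n]].

Lemma in_slice H n a : (a \in slice H n) = ((n, a) \in H).
Proof.
apply/imfsetP/idP => [[[m b]]|naH]; last by exists (n, a) => //=; rewrite !inE naH /=.
by rewrite !inE /= => /andP[mbH /eqP <-] ->.
Qed.

Lemma sliceU H H' n : slice (H `|` H') n = slice H n `|` slice H' n.
Proof. by apply/fsetP => a; rewrite !(in_slice, inE). Qed.

(** The membership condition is reflected into a boolean so that conditions form a subtype and
    inherit its choice structure. *)
Record power_cond := PowerCond {
  power_set :> {fset nat * T};
  _ : `[< forall n, K (slice power_set n) >] }.

HB.instance Definition _ := [isSub for power_set].
HB.instance Definition _ := [Choice of power_cond by <:].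

Definition power_le (p q : power_cond) : bool := q `<=` p.

Lemma power_le_refl : reflexive power_le.
Proof. by move=> p; exact: fsubset_refl. Qed.

Lemma power_le_anti : antisymmetric power_le.
Proof. by move=> p q pq; apply/val_inj/eqP; rewrite eqEfsubset andbC. Qed.

Lemma power_le_trans : transitive power_le.
Proof. by move=> q p s qp sq; exact: fsubset_trans sq qp. Qed.

HB.instance Definition _ := Order.Le_isPOrder.Build Order.default_display
  power_cond power_le_refl power_le_anti power_le_trans.

Lemma power_condP (p : power_cond) n : K (slice p n).
Proof. by case: p => H /= /asboolP. Qed.

Lemma power_leE (p q : power_cond) : (p <= q)%O = (power_set q `<=` power_set p).
Proof. by []. Qed.

Definition slice_bound (H : {fset nat * T}) : nat := \max_(z <- H) z.1.+1.

Lemma slice_out H n : (slice_bound H <= n)%N -> slice H n = fset0.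
Proof.
move=> Hn; apply/fsetP => a; rewrite in_slice inE; apply/negP => naH.
have : (n.+1 <= slice_bound H)%N.
  exact: (@leq_bigmax_seq _ (enum_fset H) xpredT (fun z : nat * T => z.1.+1) (n, a)) naH isT.
by rewrite ltnNge Hn.
Qed.

Context (code : {fset T} -> nat) (K0 : K fset0).
Hypothesis linked : forall p q, K p -> K q -> code p = code q -> K (p `|` q).

Definition power_code (p : power_cond) : seq nat :=
  mkseq (code \o slice p) (slice_bound p).

(** Slices below the common bound have equal codes, so [linked] applies to them; all later slices
    are empty. *)
Lemma power_code_compatible p q : power_code p = power_code q ->
  exists r : power_cond, power_set r = power_set p `|` power_set q.
Proof.
move=> pq.
have bE : slice_bound p = slice_bound q.
  by have := congr1 size pq; rewrite !size_mkseq.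
have rP : `[< forall n, K (slice (power_set p `|` power_set q) n) >].
  apply/asboolP => n; rewrite sliceU.
  have [nb|bn] := ltnP n (slice_bound p).
    apply: linked; rewrite ?power_condP//; try exact: power_condP.
    have := congr1 (nth 0%N ^~ n) pq.
    by rewrite /power_code !nth_mkseq// -bE.
  by rewrite !slice_out ?fset0U -?bE.
by exists (PowerCond rP).
Qed.

(** Codes are finite sequences of numbers, and no two members of an antichain share a code. *)
Lemma power_ccc : ccc power_cond.
Proof.
move=> A Aanti; apply/countable_injP.
exists (fun p => choice.pickle (power_code p)) => p q.
rewrite !inE => Ap Aq /(pcan_inj choice.pickleK)/power_code_compatible[r rE].
apply: contrapT => pq; apply: (Aanti _ _ Ap Aq pq).
by exists r; rewrite power_leE rE ?fsubsetUl ?fsubsetUr.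
Qed.

End FinitePower.

(** A filter meeting every [D a] puts each [a] into some slice; [Z n] collects the [n]-th slices of
    its conditions. *)
Lemma martin_axiom_cover (R : realType) (T : choiceType) (I : set T)
    (K : {fset T} -> Prop) (code : {fset T} -> nat) :
  martin_axiom R -> card_lt I [set: R] ->
  K fset0 ->
  (forall p q, (p `<=` q)%fset -> K q -> K p) ->
  (forall p q, K p -> K q -> code p = code q -> K (p `|` q)%fset) ->
  (forall a, I a -> K [fset a]%fset) ->
  exists Z : nat -> set T, I `<=` \bigcup_n Z n /\
    forall n (p : {fset T}), [set` p] `<=` Z n -> K p.
Proof.
move=> MA [IR nRI] K0 Ksub linked K1.
pose D a := [set p : power_cond K | exists n, (n, a) \in power_set p].
have empP : `[< forall n, K (slice fset0 n) >].
  apply/asboolP => n; suff -> : slice fset0 n = fset0 :> {fset T} by [].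
  by apply/fsetP => a; rewrite in_slice !inE.
(* The slice of [p] at [n] is empty, so [a] can be put there alone. *)
have D_dense a : I a -> po_dense (D a).
  move=> Ia p; set n := slice_bound (power_set p).
  have qP : `[< forall m, K (slice ((n, a) |` power_set p)%fset m) >].
    apply/asboolP => m; have [->|mn] := eqVneq m n.
      apply: Ksub (K1 _ Ia); apply/fsubsetP => b.
      rewrite in_slice !inE -in_slice slice_out// inE orbF.
      by rewrite xpair_eqE => /andP[].
    apply: Ksub (power_condP p m); apply/fsubsetP => b.
    by rewrite !in_slice !inE xpair_eqE (negPf mn).
  exists (PowerCond qP); last by rewrite power_leE /= fsubsetUr.
  by exists n; rewrite /= !inE eqxx.
have [||_ [a Ia <-]|G [[p0 Gp0] Gup Gdir] GD] :=
    MA _ (power_cond K) _ (power_ccc K0 linked) (D @` I).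
- by exists (PowerCond empP).
- split; first exact: card_le_trans (card_image_le _ _) IR.
  by move=> RD; apply: nRI; apply: card_le_trans RD (card_image_le _ _).
- exact: D_dense.
exists (fun n => [set a | exists2 p, G p & (n, a) \in power_set p]); split.
  move=> a Ia; have [p [Gp [n np]]] : G `&` D a !=set0 by apply: GD; exists a.
  by exists n => //; exists p.
move=> n p pZ.
(* By directedness, one condition of the filter has the whole finite set [p] in its [n]-th slice. *)
suff [q Gq qp] : exists2 q, G q &
    forall a, a \in enum_fset p -> (n, a) \in power_set q.
  apply: Ksub (power_condP q n); apply/fsubsetP => a ap.
  by rewrite in_slice; exact: qp.
have : forall a, a \in enum_fset p -> exists2 q, G q & (n, a) \in power_set q.
  by move=> a ap; exact: pZ.
elim: (enum_fset p) => [|a s IH] sZ; first by exists p0.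
have [b bs|q Gq qs] := IH; first by apply: sZ; rewrite inE bs orbT.
have [|q' Gq' q'a] := sZ a; first by rewrite inE eqxx.
have [q'' [Gq'' q''q q''q']] := Gdir _ _ Gq Gq'.
exists q'' => // b; rewrite inE => /orP[/eqP->|/qs bq].
  by apply: (fsubsetP q''q').
by apply: (fsubsetP q''q).
Qed.

(** * Interpolation by finitely supported functionals *)

Section FiniteFunctionals.
Context (R : realType).
Implicit Types (v : linf R) (m : {poly R}).

(* Polynomials encode the finitely supported elements of [l_1], acting on
   [l_oo] by summation; [fs_norm] is the [l_1] norm. *)
Definition fs_ev m v : R := \sum_(i < size m) m`_i * v i.
Definition fs_norm m : R := \sum_(i < size m) `|m`_i|.

Lemma fs_evE n m v : (size m <= n)%N -> fs_ev m v = \sum_(i < n) m`_i * v i.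
Proof.
move=> mn; rewrite /fs_ev (big_ord_widen n (fun i => m`_i * v i) mn) big_mkcond.
by apply: eq_bigr => i _; case: ltnP => // ?; rewrite nth_default ?mul0r.
Qed.

Lemma fs_normE n m : (size m <= n)%N -> fs_norm m = \sum_(i < n) `|m`_i|.
Proof.
move=> mn; rewrite /fs_norm (big_ord_widen n (fun i => `|m`_i|) mn) big_mkcond.
by apply: eq_bigr => i _; case: ltnP => // ?; rewrite nth_default ?normr0.
Qed.

Lemma fs_evDl m m' v : fs_ev (m + m') v = fs_ev m v + fs_ev m' v.
Proof.
set n := maxn (size m) (size m').
rewrite !(@fs_evE n) ?leq_maxl ?leq_maxr ?size_polyD//.
by rewrite -big_split; apply: eq_bigr => i _; rewrite coefD mulrDl.
Qed.

Lemma fs_evZl c m v : fs_ev (c *: m) v = c * fs_ev m v.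
Proof.
rewrite !(@fs_evE (size m)) ?size_scale_leq// mulr_sumr.
by apply: eq_bigr => i _; rewrite coefZ mulrA.
Qed.

Lemma fs_ev0l v : fs_ev 0 v = 0.
Proof. by rewrite /fs_ev size_poly0 big_ord0. Qed.

Lemma fs_evNl m v : fs_ev (- m) v = - fs_ev m v.
Proof. by rewrite -scaleN1r fs_evZl mulN1r. Qed.

Lemma fs_ev_suml (I : Type) (s : seq I) (F : I -> {poly R}) v :
  fs_ev (\sum_(i <- s) F i) v = \sum_(i <- s) fs_ev (F i) v.
Proof. exact: (big_morph (fs_ev^~ v) (fun m m' => fs_evDl m m' v) (fs_ev0l v)). Qed.

Lemma fs_evDr m v v' : fs_ev m (v + v') = fs_ev m v + fs_ev m v'.
Proof. by rewrite -big_split; apply: eq_bigr => i _; exact: mulrDr. Qed.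

Lemma fs_evZr m c v : fs_ev m (c *: v) = c * fs_ev m v.
Proof. by rewrite mulr_sumr; apply: eq_bigr => i _; exact: mulrCA. Qed.

Lemma fs_ev0r m : fs_ev m 0 = 0.
Proof. by rewrite -(scale0r 0) fs_evZr mul0r. Qed.

Lemma fs_evBr m v v' : fs_ev m (v - v') = fs_ev m v - fs_ev m v'.
Proof. by rewrite fs_evDr -scaleN1r fs_evZr mulN1r. Qed.

Lemma fs_ev_sumr m (I : Type) (s : seq I) (P : pred I) (F : I -> linf R) :
  fs_ev m (\sum_(i <- s | P i) F i) = \sum_(i <- s | P i) fs_ev m (F i).
Proof. exact: (big_morph (fs_ev m) (fs_evDr m) (fs_ev0r m)). Qed.

Lemma fs_evXn n v : fs_ev 'X^n v = v n.
Proof.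
rewrite (@fs_evE n.+1) ?size_polyXn// big_ord_recr /= coefXn eqxx mul1r.
rewrite big1 ?add0r// => i _; rewrite coefXn.
by rewrite ltn_eqF// mul0r.
Qed.

Lemma fs_normXn n : fs_norm 'X^n = 1.
Proof.
rewrite (@fs_normE n.+1) ?size_polyXn// big_ord_recr /= coefXn eqxx normr1.
rewrite big1 ?add0r// => i _; rewrite coefXn.
by rewrite ltn_eqF// normr0.
Qed.

Lemma fs_norm_ge0 m : 0 <= fs_norm m.
Proof. exact: sumr_ge0. Qed.

Lemma fs_norm0 : fs_norm 0 = 0.
Proof. by rewrite /fs_norm size_poly0 big_ord0. Qed.

Lemma fs_normD m m' : fs_norm (m + m') <= fs_norm m + fs_norm m'.
Proof.
set n := maxn (size m) (size m').
rewrite !(@fs_normE n) ?leq_maxl ?leq_maxr ?size_polyD//.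
by rewrite -big_split; apply: ler_sum => i _; rewrite coefD ler_normD.
Qed.

Lemma fs_normZ c m : fs_norm (c *: m) = `|c| * fs_norm m.
Proof.
rewrite !(@fs_normE (size m)) ?size_scale_leq// mulr_sumr.
by apply: eq_bigr => i _; rewrite coefZ normrM.
Qed.

Lemma fs_normN m : fs_norm (- m) = fs_norm m.
Proof. by rewrite -scaleN1r fs_normZ normrN1 mul1r. Qed.

Lemma fs_norm_sum (I : eqType) (s : seq I) (F : I -> {poly R}) (b : R) :
  {in s, forall i, fs_norm (F i) <= b} ->
  fs_norm (\sum_(i <- s) F i) <= b *+ size s.
Proof.
elim: s => [|i s IH] Fb; first by rewrite big_nil fs_norm0 mulr0n.
rewrite big_cons mulrS; apply: le_trans (fs_normD _ _) _; apply: lerD.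
  by apply: Fb; rewrite inE eqxx.
by apply: IH => j js; apply: Fb; rewrite inE js orbT.
Qed.

Lemma linf_coord_le v n : `|v n| <= `|v|.
Proof. exact: le_linf_norm. Qed.

Lemma fs_ev_le m v : `|fs_ev m v| <= fs_norm m * `|v|.
Proof.
apply: le_trans (ler_norm_sum _ _ _) _; rewrite mulr_suml; apply: ler_sum => i _.
by rewrite normrM ler_wpM2l// linf_coord_le.
Qed.

Lemma linf_sum_coord (I : Type) (s : seq I) (F : I -> linf R) n :
  (\sum_(i <- s) F i) n = \sum_(i <- s) F i n.
Proof. exact: (big_morph (fun f : linf R => f n) (fun _ _ => erefl) erefl). Qed.

(** The supremum need not be attained, hence the loss of a factor 2. *)
Lemma linf_coord_ge v (d : R) : 0 < d -> d <= `|v| -> exists n, d / 2 <= `|v n|.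
Proof.
move=> d0 dv; apply: contrapT => /forallNP vn.
suff : `|v| <= d / 2 by apply/negP; rewrite -ltNge (lt_le_trans _ dv)// ltr_pdivrMr// mulr_natr mulr2n ltrDl.
by apply: linf_norm_le => n; have /negP := vn n; rewrite -ltNge => /ltW.
Qed.

Section Interpolation.
Context (d M : R) (W : set (linf R)).
Hypotheses (d0 : 0 < d) (M0 : 0 <= M) (WM : forall v, W v -> `|v| <= M).

Definition far v (s : seq (linf R)) : Prop :=
  forall c : linf R -> R, d <= `|v - \sum_(u <- s) c u *: u|.

Hypothesis Wfar : forall s : seq (linf R), s <> [::] -> uniq s ->
  [set` s] `<=` W -> exists2 v, v \in s & far v (rem v s).

(** Induction on the number of vectors. Some [v] is far from the span of the others, [t].
    Subtracting from [v] its interpolated part in that span leaves a vector [u0] with a coordinate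
    [k] of modulus at least [d / 2]. Evaluation at [k], corrected on [t] and normalized, is a
    functional [w] that vanishes on [t] and is 1 at [v]; a multiple of it repairs the interpolant
    for [t]. *)
Lemma interpolation n : exists2 C : R, 0 <= C &
  forall s : seq (linf R), uniq s -> [set` s] `<=` W -> (size s <= n)%N ->
  forall (e : linf R -> R) eta, 0 <= eta -> {in s, forall v, `|e v| <= eta} ->
  exists2 m, fs_norm m <= C * eta & {in s, forall v, fs_ev m v = e v}.
Proof.
elim: n => [|n [C C0 IH]].
  exists 0 => // s _ _; rewrite leqn0 size_eq0 => /eqP-> e eta _ _.
  by exists 0; rewrite ?fs_norm0 ?mul0r.
(* A bound for the norm of [w]: 1 comes from the evaluation at [k], and [M * C] from each correcting
   term. *)
pose N := (d / 2)^-1 * (1 + (M * C) *+ n).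
have d20 : 0 < d / 2 by rewrite divr_gt0.
have MCn0 : 0 <= (M * C) *+ n by rewrite mulrn_wge0// mulr_ge0.
have N0 : 0 <= N by rewrite mulr_ge0 ?invr_ge0 ?(ltW d20)// addr_ge0.
(* [C] accounts for the interpolant on [t], and [(1 + C * M) * eta] bounds its error at [v], the
   coefficient of [w]. *)
exists (C + (1 + C * M) * N) => [|s us sW sn e eta eta0 e_eta].
  by rewrite addr_ge0// mulr_ge0// addr_ge0// mulr_ge0.
have [->|/eqP s0] := eqVneq s [::].
  exists 0 => //; rewrite fs_norm0 mulr_ge0// addr_ge0// mulr_ge0// addr_ge0//.
  by rewrite mulr_ge0.
have [v vs vfar] := Wfar s0 us sW.
set t := rem v s in vfar.
have ut : uniq t by exact: rem_uniq.
have ts : {subset t <= s} by exact: mem_rem.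
have tW : [set` t] `<=` W by move=> u /= /ts; exact: sW.
have tn : (size t <= n)%N by rewrite size_rem// -subn1 leq_subLR add1n.
(* The functionals [mu u] are biorthogonal to the vectors of [t]. *)
have /choice[mu muP] : forall u, exists m, u \in t -> fs_norm m <= C /\
    {in t, forall u', fs_ev m u' = (u' == u)%:R}.
  move=> u; have [|m mC mt] := IH t ut tW tn (fun u' => (u' == u)%:R) 1 ler01.
    by move=> u' _; case: eqP; rewrite ?normr1 ?normr0.
  by exists m => _; split=> //; rewrite -[C]mulr1.
set u0 := v - \sum_(u <- t) fs_ev (mu u) v *: u.
have [k u0k] := linf_coord_ge d0 (vfar (fun u => fs_ev (mu u) v)).
rewrite -/u0 in u0k.
have u0k0 : u0 k != 0 by rewrite -normr_gt0 (lt_le_trans _ u0k).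
have u0kE : u0 k = v k - \sum_(u <- t) u k * fs_ev (mu u) v.
  transitivity (v k - (\sum_(u <- t) fs_ev (mu u) v *: u) k); first by [].
  by rewrite linf_sum_coord; congr (_ - _); apply: eq_bigr => u _; rewrite mulrC.
clearbody u0; pose w := (u0 k)^-1 *: ('X^k - \sum_(u <- t) u k *: mu u).
have wE u : fs_ev w u =
    (u0 k)^-1 * (u k - \sum_(u' <- t) u' k * fs_ev (mu u') u).
  rewrite fs_evZl fs_evDl fs_evNl fs_evXn fs_ev_suml.
  by congr (_ * (_ - _)); apply: eq_bigr => u' _; rewrite fs_evZl.
have wt : {in t, forall u, fs_ev w u = 0}.
  move=> u ut'; rewrite wE (bigD1_seq u)//= (muP u ut').2// eqxx mulr1.
  rewrite big_seq_cond big1 ?addr0 ?subrr ?mulr0// => u' /andP[u't uu'].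
  by rewrite (muP u' u't).2// eq_sym (negPf uu') mulr0.
have wv : fs_ev w v = 1 by rewrite wE -u0kE mulVf.
have wN : fs_norm w <= N.
  rewrite fs_normZ; apply: ler_pM => //; first exact: fs_norm_ge0.
    by rewrite normrV ?unitfE// lef_pV2 ?posrE ?normr_gt0.
  apply: le_trans (fs_normD _ _) _; rewrite fs_normXn fs_normN lerD2l.
  apply: (@le_trans _ _ ((M * C) *+ size t)).
    apply: fs_norm_sum => u ut'; rewrite fs_normZ; apply: ler_pM => //.
    - exact: fs_norm_ge0.
    - by apply: le_trans (linf_coord_le _ _) (WM _); exact: tW.
    - by have [] := muP u ut'.
  by rewrite ler_wpMn2l// mulr_ge0.
have [|m' m'C m't] := IH t ut tW tn e eta eta0.
  by move=> u /ts; exact: e_eta.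
exists (m' + (e v - fs_ev m' v) *: w).
  apply: le_trans (fs_normD _ _) _; rewrite mulrDl lerD// fs_normZ mulrAC.
  apply: ler_pM => //; first exact: fs_norm_ge0.
  apply: le_trans (ler_normB _ _) _; rewrite mulrDl mul1r lerD ?e_eta//.
  apply: le_trans (fs_ev_le _ _) _; rewrite mulrAC; apply: ler_pM => //.
    exact: fs_norm_ge0.
  by apply: WM; exact: sW.
move=> u us'; rewrite fs_evDl fs_evZl; have [->|uv] := eqVneq u v.
  by rewrite wv mulr1 addrC subrK.
have ut' : u \in t by rewrite mem_rem_uniq// inE uv.
by rewrite wt// mulr0 addr0 m't.
Qed.

End Interpolation.
End FiniteFunctionals.

Section RationalApproximation.
Context (R : realType).

Lemma ratr_approx (a e : R) : 0 < e -> exists q : rat, `|a - ratr q| < e.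
Proof.
move=> e0; have [|q] := @rat_in_itvoo R (a - e) (a + e).
  by rewrite ltrBlDr -addrA ltrDl addr_gt0.
rewrite in_itv /= => /andP[aq qa]; exists q.
by rewrite distrC ltr_distl aq qa.
Qed.

(** Rational polynomials form a countable dense set, which supplies the codes in [killed_linked]. *)
Lemma fs_norm_ratr_approx (m : {poly R}) (e : R) : 0 < e ->
  exists c : {poly rat}, fs_norm (m - map_poly ratr c) < e.
Proof.
move=> e0; set n := size m.
(* With [n.+1] in place of [n], the [n] errors add up to strictly less than [e], also when [n] is
   0. *)
have en0 : 0 < e / n.+1%:R by rewrite divr_gt0.
have /choice[q qP] := fun i => ratr_approx m`_i en0.
exists (\poly_(i < n) q i).
rewrite (@fs_normE _ n); last first.
  rewrite (leq_trans (size_polyD _ _))// geq_max leqnn size_polyN.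
  by rewrite (leq_trans (size_poly _ _)) ?size_map_poly ?size_poly.
apply: (@le_lt_trans _ _ (\sum_(i < n) e / n.+1%:R)).
  apply: ler_sum => i _.
  by rewrite coefB coef_map coef_poly ltn_ord ltW.
rewrite sumr_const card_ord -[ltLHS]mulr_natr -mulrA gtr_pMr//.
by rewrite mulrC ltr_pdivrMr// mul1r ltr_nat.
Qed.

End RationalApproximation.

(** * Sigma-linkedness of the finite sets annihilated with a common bound *)

Section SigmaLinked.
Context (R : realType) (T : choiceType) (I : set T) (g : T -> linf R).
Context (x : linf R) (d M : R).
Hypotheses (d0 : 0 < d) (M0 : 0 <= M).
Let W := x |` (g @` I).
Hypotheses (xg : forall a, I a -> g a <> x) (WM : forall v, W v -> `|v| <= M).
Hypothesis Wfar : forall s : seq (linf R), s <> [::] -> uniq s ->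
  [set` s] `<=` W -> exists2 v, v \in s & far d v (rem v s).

(** The strict bound leaves room below [L] for a small correction. *)
Definition killed (L : R) (p : {fset T}) : Prop := [set` p] `<=` I /\
  exists m, [/\ fs_norm m < L, fs_ev m x = 1 &
    forall a, a \in p -> fs_ev m (g a) = 0].

Lemma killed_subset L p q : (p `<=` q)%fset -> killed L q -> killed L p.
Proof.
move=> /fsubsetP pq [qI [m [mL mx mq]]]; split; first by move=> a /pq /qI.
by exists m; split=> // a /pq /mq.
Qed.

(** The interpolation constant for two vectors serves all [a] at once; adding 1 makes the bound
    strict. *)
Lemma killed_fset1 : exists L, forall a, I a -> killed L [fset a]%fset.
Proof.
have [C C0 CP] := interpolation d0 M0 WM Wfar 2.
exists (C + 1) => a Ia; split; first by move=> b /=; rewrite inE => /eqP->.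
have us : uniq [:: x; g a].
  by rewrite /= inE andbT; apply/eqP => /esym; exact: xg.
have sW : [set` [:: x; g a]] `<=` W.
  by move=> v /=; rewrite !inE => /orP[/eqP->|/eqP->]; [left|right; exists a].
have [|m mC ms] := CP _ us sW (leqnn _) (fun v => (v == x)%:R) 1 ler01.
  by move=> v _; case: eqP; rewrite ?normr1 ?normr0.
exists m; split.
- by rewrite (le_lt_trans mC)// mulr1 ltrDl.
- by rewrite ms ?inE ?eqxx.
move=> b; rewrite inE => /eqP->; rewrite ms ?inE ?eqxx ?orbT//.
by have /eqP/negPf-> := xg Ia.
Qed.

(** The code of [p] records its size [n], a number [k] such that the slack below [L] is at least
    [1 / (k + 1)], and a rational approximation of its functional. If [q] has the same code, the
    functional of [p] is nearly 0 on the vectors of [q], and a correction smaller than the slack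
    makes it vanish there. *)
Lemma killed_linked L : exists code : {fset T} -> nat, forall p q,
  killed L p -> killed L q -> code p = code q -> killed L (p `|` q)%fset.
Proof.
have /choice[C CP] : forall n, exists C : R, 0 <= C /\
    forall s : seq (linf R), uniq s -> [set` s] `<=` W -> (size s <= n)%N ->
    forall (e : linf R -> R) eta, 0 <= eta -> {in s, forall v, `|e v| <= eta} ->
    exists2 m, fs_norm m <= C * eta & {in s, forall v, fs_ev m v = e v}.
  by move=> n; have [C C0 CP] := interpolation d0 M0 WM Wfar n; exists C.
(* At most [2n + 1] vectors occur: [x] and the images of [p] and [q]. The factor 2 arises because
   both functionals are within [eta] of the same rational one. *)
pose D n := C (n + n)%N.+1 * (M *+ 2).
have D0 n : 0 <= D n by rewrite mulr_ge0 ?mulrn_wge0//; have [] := CP (n + n)%N.+1.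
(* This makes the norm of the correction, at most [D n * eta n k], smaller than [1 / (k + 1)]. *)
pose eta n k : R := (k.+1%:R * (D n + 1))^-1.
have eta0 n k : 0 < eta n k by rewrite invr_gt0 mulr_gt0// ltr_wpDl.
pose data p (z : nat * nat * {poly rat}) : Prop := #|` p| = z.1.1 /\
  exists m, [/\ fs_norm m + z.1.2.+1%:R^-1 <= L, fs_ev m x = 1,
    forall a, a \in p -> fs_ev m (g a) = 0 &
    fs_norm (m - map_poly ratr z.2) < eta z.1.1 z.1.2].
have /choice[z zP] : forall p, exists z, killed L p -> data p z.
  move=> p; have [[pI [m [mL mx mp]]]|] := pselect (killed L p); last first.
    by exists (0%N, 0%N, 0).
  have [k kL] : exists k : nat, fs_norm m + k.+1%:R^-1 <= L.
    have [k] := ltr_add_invr mL.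
    by exists k; exact: ltW.
  have [c mc] := fs_norm_ratr_approx m (eta0 #|` p| k).
  by exists (#|` p|, k, c) => _; split=> //; exists m.
exists (fun p => choice.pickle (z p)) => p q Kp Kq /(pcan_inj choice.pickleK) zpq.
have [[pI _] [qI _]] := (Kp, Kq).
have [] := zP _ Kq; have [] := zP _ Kp; rewrite -zpq.
case: (z p) => [[n k] c] /= pn [m [mL mx mp mc]] qn [m' [_ _ m'q m'c]].
split; first by move=> a /=; rewrite inE => /orP[/pI|/qI].
have mm' : fs_norm (m - m') <= eta n k *+ 2.
  have -> : m - m' = (m - map_poly ratr c) - (m' - map_poly ratr c).
    by rewrite opprB addrA subrK.
  by rewrite (le_trans (fs_normD _ _))// fs_normN mulr2n lerD// ltW.
(* The correction keeps the value at [x] and cancels [m] elsewhere. *)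
pose e v := if v == x then 0 else - fs_ev m v.
pose s := undup (x :: map g (p `|` q)%fset).
have sP v : v \in s -> v = x \/ exists2 a, v = g a & a \in p \/ a \in q.
  rewrite mem_undup inE => /orP[/eqP|/mapP[a]]; first by left.
  by rewrite inE => /orP aE ->; right; exists a.
have sW : [set` s] `<=` W.
  move=> v /= /sP[->|[a -> aE]]; [by left|right; exists a => //].
  by case: aE => [/pI|/qI].
have sn : (size s <= (n + n)%N.+1)%N.
  rewrite (leq_trans (size_undup _))//= ltnS size_map.
  by rewrite -{1}pn -qn -cardfsUI leq_addr.
have eM : {in s, forall v, `|e v| <= eta n k *+ 2 * M}.
  have eM0 : 0 <= eta n k *+ 2 * M by rewrite mulr_ge0// mulrn_wge0// ltW.
  move=> v vs; rewrite /e; case: eqP => [_|vx]; first by rewrite normr0.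
  have [//|[a vE [ap|aq]]] := sP _ vs; first by rewrite vE mp// oppr0 normr0.
  (* For [a] in [q], [m'] vanishes at [g a], so [m] takes there the value of the small functional
     [m - m']. *)
  rewrite normrN -[fs_ev m v]subr0 -(m'q _ aq) -vE -fs_evNl -fs_evDl.
  apply: le_trans (fs_ev_le _ _) _; apply: ler_pM => //; first exact: fs_norm_ge0.
  by apply: WM; exact: sW.
have eM0 : 0 <= eta n k *+ 2 * M by rewrite mulr_ge0// mulrn_wge0// ltW.
have [C0 CE] := CP (n + n)%N.+1.
have [w wN ws] := CE s (undup_uniq _) sW sn e _ eM0 eM.
exists (m + w); split.
- apply: le_lt_trans (fs_normD _ _) _; apply: lt_le_trans mL.
  rewrite ltrD2l; apply: le_lt_trans wN _.
  rewrite mulrnAl -mulrnAr mulrCA -/(D n) mulrC /eta invfM mulrA.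
  rewrite ltr_pdivrMr ?ltr_wpDl// mulrC ltr_pM2l ?invr_gt0// ltrDl ltr01//.
- rewrite fs_evDl mx ws ?mem_undup ?inE ?eqxx//.
  by rewrite /e eqxx addr0.
move=> a apq; have Ia : I a by move: apq; rewrite inE => /orP[/pI|/qI].
rewrite fs_evDl ws; last by rewrite mem_undup inE map_f ?orbT.
by rewrite /e; have /eqP/negPf-> := xg Ia; rewrite subrr.
Qed.

End SigmaLinked.

(** * Closed spans and the application of Martin's axiom *)

Section NormedClosure.
Context (R : realType) (V : completeNormedModType R).
Implicit Types (S D : set V) (v : V).

Lemma closure_normP S v :
  closure S v <-> forall e : R, 0 < e -> exists2 u, S u & `|v - u| < e.
Proof.
split=> [Sv e e0|Sv B].
  have [u [Su]] := Sv _ (nbhsx_ballx v e e0).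
  by rewrite -ball_normE; exists u.
move=> /nbhs_ballP[e /= e0 eB]; have [u Su uv] := Sv _ e0.
by exists u; split=> //; apply: eB; rewrite -ball_normE.
Qed.

Lemma not_closure_dist S v : ~ closure S v ->
  exists2 e : R, 0 < e & forall u, S u -> e <= `|v - u|.
Proof.
move=> nS; apply: contrapT => nd; apply: nS; apply/closure_normP => e e0.
apply: contrapT => nu; apply: nd; exists e => // u Su.
by rewrite leNgt; apply/negP => ue; apply: nu; exists u.
Qed.

Lemma linear_span_sum (I : eqType) S (s : seq I) (c : I -> R) (F : I -> V) :
  {in s, forall i, S (F i)} -> linear_span S (\sum_(i <- s) c i *: F i).
Proof.
move=> sS; pose t := in_tuple s.
exists (size s), (fun i => c (tnth t i)), (fun i => F (tnth t i)).
by split=> [i|]; [exact/sS/mem_tnth|rewrite big_tnth].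
Qed.

Lemma sub_linear_span S : S `<=` linear_span S.
Proof.
move=> v Sv; have := @linear_span_sum _ S [:: v] (fun=> 1) id.
by rewrite big_seq1 scale1r; apply=> u; rewrite inE => /eqP->.
Qed.

End NormedClosure.

(** [gfar] is a triangular independence. Martin's axiom makes it uniform on a large set of indices:
    functionals of norm below a single [L] annihilate any finitely many values and send [x] to 1. *)
Lemma martin_axiom_not_dense (R : realType) (T : pointedType) (A : set T)
    (r : rel T) (g : T -> linf R) (x : linf R) :
  martin_axiom R -> card_lt A [set: R] -> uncountable_cofinality A ->
  wo_chain r (mem A) -> x != 0 ->
  (forall a, A a -> ~ closure (linear_span (x |` (g @` init_seg A r a))) (g a)) ->
  exists Z, [/\ Z `<=` A, A #<= g @` Z & ~ closure (linear_span (g @` Z)) x].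
Proof.
move=> MA [AR nRA] Acof Awo x0 gfar.
have gx a : A a -> g a <> x.
  move=> Aa gax; apply: (gfar a Aa); apply: subset_closure.
  by apply: sub_linear_span; left.
have glt a b : A a -> A b -> r a b -> a <> b -> g a <> g b.
  move=> Aa Ab rab ab gab; apply: (gfar b Ab); apply: subset_closure.
  by apply: sub_linear_span; right; exists a.
have ginj a b : A a -> A b -> g a = g b -> a = b.
  move=> Aa Ab gab; apply: contrapT => ab.
  have [rab|rba] := wo_total Awo Aa Ab; first exact: glt gab.
  by apply: (glt b a) => // /esym.
(* One number controls both the norm of [g a] and its distance from the earlier span, so a single
   fibre of [h] makes both uniform. *)
have /choice[h hP] : forall a, exists n : nat, A a -> `|g a| <= n%:R /\
    forall u, linear_span (x |` (g @` init_seg A r a)) u ->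
      n.+1%:R^-1 <= `|g a - u|.
  move=> a; have [Aa|] := pselect (A a); last by exists 0%N.
  have [e e0 eP] := not_closure_dist (gfar a Aa).
  have [k] := ltr_add_invr e0; rewrite add0r => ke.
  exists (maxn k (Num.trunc `|g a|).+1) => _; split.
    rewrite ltW// (lt_le_trans (truncnS_gt _))// ler_nat leq_maxr//.
  move=> u /eP; apply: le_trans; apply: le_trans (ltW ke).
  by rewrite lef_pV2 ?posrE// ler_nat ltnS leq_maxl.
have [n An] := uncountable_cofinality_fibre h Acof.
set I := [set a | A a /\ h a = n] in An.
have IA : I `<=` A by move=> a [].
(* The norm of [x] enters because the list may be [x] alone, whose distance from the zero span is
   that norm. *)
pose d := Num.min (n.+1%:R^-1) `|x|.
have d0 : 0 < d by rewrite lt_min invr_gt0 ltr0n normr_gt0.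
pose M := n%:R + `|x|.
have M0 : 0 <= M by rewrite addr_ge0.
have WM v : (x |` (g @` I)) v -> `|v| <= M.
  move=> [->|[a [Aa ha] <-]]; first by rewrite lerDr.
  by have [ga _] := hP _ Aa; rewrite ha in ga; rewrite (le_trans ga)// lerDl.
(* The vector that is far from the others in a list will be the one of last index. *)
have smax (s : seq (linf R)) : (exists2 a, I a & g a \in s) ->
    exists a, [/\ I a, g a \in s & forall b, I b -> g b \in s -> r b a].
  elim: s => [[a _]//|u s IH] [a0 Ia0 ga0].
  have [/IH[a [Ia gas amax]]|nos] := pselect (exists2 a, I a & g a \in s).
    have [[b Ib gbu]|nou] := pselect (exists2 b, I b & g b = u).
      have [rab|rba] := wo_total Awo (IA _ Ia) (IA _ Ib).
        exists b; split=> [//||c Ic]; first by rewrite inE gbu eqxx.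
        rewrite inE => /orP[/eqP gcu|/(amax _ Ic) rca].
          rewrite (ginj c b) ?gcu ?gbu //; try exact: IA.
          by apply: (wo_refl Awo); exact: IA.
        by apply: (wo_trans Awo _ _ _ rca rab); exact: IA.
      exists a; split=> [//||c Ic]; first by rewrite inE gas orbT.
      rewrite inE => /orP[/eqP gcu|/(amax _ Ic)//].
      by rewrite (ginj c b) ?gcu ?gbu //; exact: IA.
    exists a; split=> [//||c Ic]; first by rewrite inE gas orbT.
    rewrite inE => /orP[/eqP gcu|/(amax _ Ic)//].
    by case: nou; exists c.
  have gs b : I b -> g b \in s -> False by move=> Ib gbs; apply: nos; exists b.
  move: ga0; rewrite inE => /orP[/eqP gau|/(gs _ Ia0)//].
  exists a0; split=> [//||c Ic]; first by rewrite inE gau eqxx.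
  rewrite inE => /orP[/eqP gcu|/(gs _ Ic)//].
  rewrite (ginj c a0) ?gcu ?gau //; try exact: IA.
  by apply: (wo_refl Awo); exact: IA.
have Wfar (s : seq (linf R)) : s <> [::] -> uniq s ->
    [set` s] `<=` x |` (g @` I) -> exists2 v, v \in s & far d v (rem v s).
  move=> s0 us sW.
  have [/smax[a [Ia gas amax]]|nos] := pselect (exists2 a, I a & g a \in s).
    exists (g a) => // c; have [Aa ha] := Ia; have [_ aP] := hP _ Aa.
    rewrite ha in aP; apply: (@le_trans _ _ n.+1%:R^-1).
      by rewrite ge_min lexx.
    (* All other vectors of the list are [x] or values at earlier indices. *)
    apply: aP; apply: (@linear_span_sum _ _ _ _ _ c id) => u.
    rewrite mem_rem_uniq// inE => /andP[/eqP uga us'].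
    have [->|[b Ib gbu]] := sW _ us'; [by left|right].
    exists b => //; split; first exact: IA.
      by apply: amax => //; rewrite gbu.
    by move=> ba; apply: uga; rewrite -gbu ba.
  have sx u : u \in s -> u = x.
    move=> us'; have [//|[a Ia gau]] := sW _ us'.
    by case: nos; exists a => //; rewrite gau.
  case: s => [//|u s] in s0 us sW nos sx *.
  exists u; first by rewrite inE eqxx.
  move=> c; rewrite /= eqxx.
  case: s => [|w s] in s0 us sW nos sx *; last first.
    have ux : u = x by apply: sx; rewrite inE eqxx.
    have wx : w = x by apply: sx; rewrite !inE eqxx orbT.
    by move: us; rewrite ux wx /= inE eqxx.
  have ux : u = x by apply: sx; rewrite inE eqxx.
  by rewrite big_nil subr0 ux ge_min lexx orbT.
have gxI a : I a -> g a <> x by move=> /IA; exact: gx.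
have [L LP] := killed_fset1 d0 M0 gxI WM Wfar.
have [code codeP] := killed_linked d0 M0 gxI WM Wfar L.
have I0 : I !=set0.
  apply/set0P/negP => /eqP I0.
  apply: (uncountable_cofinality_uncountable Acof).
  by move: An; rewrite I0 card_le0 => /eqP ->.
have [a0 Ia0] := I0.
have K0 : killed I g x L fset0 by apply: killed_subset (LP _ Ia0); exact: fsub0set.
have Ilt : card_lt I [set: R].
  split; first exact: card_le_trans (subset_card_le IA) AR.
  by move=> RI; apply: nRA; apply: card_le_trans RI (subset_card_le IA).
have [Z [IZ ZP]] := martin_axiom_cover MA Ilt K0
  (fun p q => @killed_subset _ _ _ _ _ L p q) codeP LP.
have [j Aj] := uncountable_cofinality_cover Acof An IZ.
exists (I `&` Z j); split=> [a [/IA//]||].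
  apply: card_le_trans Aj _; apply: (@card_le_inj _ _ _ _ g) => [a IZa|].
    by exists a.
  by move=> a b [/IA Aa _] [/IA Ab _]; exact: ginj.
move=> /closure_normP xcl.
have [_ [m0 [m0L _ _]]] := K0.
have L0 : 0 < L by exact: le_lt_trans (fs_norm_ge0 _) m0L.
have [|u [k [c [v [vZ ->]]]] xu] := xcl L^-1; first by rewrite invr_gt0.
have /choice[b bP] : forall i, exists a, (I a /\ Z j a) /\ g a = v i.
  by move=> i; have [a ? ?] := vZ i; exists a.
(* This functional kills the approximating combination and is 1 at [x], so 1 is at most [L] times a
   distance that was taken below [1 / L]. *)
have [|_ [m [mL mx mp]]] := ZP j [fset b i | i in 'I_k]%fset.
  by move=> a /= /imfsetP[i _ ->]; have [[]] := bP i.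
have mu : fs_ev m (\sum_(i < k) c i *: v i) = 0.
  rewrite fs_ev_sumr big1// => i _; rewrite fs_evZr -(bP i).2 mp ?mulr0//.
  by apply/imfsetP; exists i.
have := fs_ev_le m (x - \sum_(i < k) c i *: v i).
rewrite fs_evBr mu subr0 mx normr1; apply/negP; rewrite -ltNge.
apply: (@le_lt_trans _ _ (L * `|x - \sum_(i < k) c i *: v i|)).
  by rewrite ler_wpM2r// ltW.
by rewrite -(mulfV (lt0r_neq0 L0)) ltr_pM2l.
Qed.

(** * The space generated by an almost disjoint family *)

Section GeneratedSpace.
Context (R : realType) (A : set (set nat)).
Let E := generated_space R A.
Let unit_vec n := linf_indic R [set n].

Lemma linf_indicE (B : set nat) n : linf_indic R B n = (n \in B)%:R.
Proof. exact: indicE. Qed.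

Lemma c0P (f : linf R) : @c0 R f <-> forall e : R, 0 < e ->
  exists N, forall n, (N <= n)%N -> `|f n| <= e.
Proof.
split=> [/cvgr0Pnorm_le f0 e e0|f0].
  by have [N _ NP] := f0 e e0; exists N.
apply/cvgr0Pnorm_le => e e0; have [N NP] := f0 e e0.
by exists N.
Qed.

Lemma unit_vec_c0 n : @c0 R (unit_vec n).
Proof.
apply/c0P => e e0; exists n.+1 => k nk; rewrite linf_indicE memNset ?normr0 ?ltW//.
by move=> /= kn; rewrite kn ltnn in nk.
Qed.

Lemma sub_generated_space : @c0 R `|` linf_indic R @` A `<=` E.
Proof. by move=> v Sv; apply: subset_closure; exact: sub_linear_span. Qed.

(** Unit vectors stand in for [c0], which has the cardinality of the continuum, so that the rational
    combinations number at most |A|. *)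
Let gens := range unit_vec `|` linf_indic R @` A.

Lemma gens_sub : gens `<=` @c0 R `|` linf_indic R @` A.
Proof. by move=> v [[n _ <-]|]; [left; exact: unit_vec_c0|right]. Qed.

Definition rat_span : set (linf R) :=
  (fun s : seq (rat * linf R) => \sum_(z <- s) ratr z.1 *: z.2) @`
    [set s | [set` s] `<=` [set: rat] `*` gens].

Lemma rat_span_card : infinite_set A -> rat_span #<= A.
Proof.
move=> Ainf; apply: card_le_trans (card_image_le _ _) _.
apply: (seqs_card_le Ainf); apply: (setX_card_le Ainf).
  by apply: (countable_card_le Ainf); exact: countableP.
have -> : gens = \bigcup_(b in [set: bool])
    (if b then range unit_vec else linf_indic R @` A).
  apply/seteqP; split=> [v [?|?]|v [[] _ ?]]; [by exists true|by exists false| |].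
  - by left.
  - by right.
apply: (bigcup_card_le Ainf) => [|[] _]; first by apply: (countable_card_le Ainf); exact: countableP.
  by apply: (countable_card_le Ainf); exact: card_image_le.
exact: card_image_le.
Qed.

Lemma rat_span_sub : rat_span `<=` E.
Proof.
move=> _ [s sG <-]; apply: subset_closure.
apply: (linear_span_sum (fun z : rat * linf R => ratr z.1)) => z zs.
by apply: gens_sub; have [] := sG _ zs.
Qed.

Lemma rat_spanD u v : rat_span u -> rat_span v -> rat_span (u + v).
Proof.
move=> [s sG <-] [t tG <-]; exists (s ++ t); rewrite ?big_cat// => z /=.
by rewrite mem_cat => /orP[/sG|/tG].
Qed.

Lemma rat_spanZ q u : rat_span u -> rat_span (ratr q *: u).
Proof.
move=> [s sG <-]; exists [seq (q * z.1, z.2) | z <- s].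
  by move=> _ /= /mapP[z /sG [_ ?] ->].
rewrite big_map scaler_sumr; apply: eq_bigr => z _ /=.
by rewrite scalerA rmorphM.
Qed.

Lemma rat_span_gens v : gens v -> rat_span v.
Proof.
move=> Gv; exists [:: (1, v)]; first by move=> z /=; rewrite inE => /eqP->.
by rewrite big_seq1 rmorph1 scale1r.
Qed.

Lemma closure_rat_spanD u v :
  closure rat_span u -> closure rat_span v -> closure rat_span (u + v).
Proof.
move=> /closure_normP cu /closure_normP cv; apply/closure_normP => e e0.
have e20 : 0 < e / 2 by rewrite divr_gt0.
have [u' Du' uu'] := cu _ e20; have [v' Dv' vv'] := cv _ e20.
exists (u' + v'); first exact: rat_spanD.
by rewrite opprD addrACA (le_lt_trans (ler_normD _ _))// [e]splitr ltrD.
Qed.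

Lemma closure_rat_spanZ (a : R) u :
  closure rat_span u -> closure rat_span (a *: u).
Proof.
move=> /closure_normP cu; apply/closure_normP => e e0.
have e20 : 0 < e / 2 by rewrite divr_gt0.
have a0 : 0 < `|a| + 1 by rewrite ltr_wpDl.
have [w Dw uw] := cu (e / 2 / (`|a| + 1)) (divr_gt0 e20 a0).
(* The rational factor is chosen after [w], as its error gets multiplied by the norm of [w]; adding
   1 avoids a zero denominator. *)
have w0 : 0 < `|w| + 1 by rewrite ltr_wpDl.
have [q aq] := ratr_approx a (divr_gt0 e20 w0).
exists (ratr q *: w); first exact: rat_spanZ.
have -> : a *: u - ratr q *: w = a *: (u - w) + (a - ratr q) *: w.
  by rewrite scalerBr scalerBl addrA subrK.
rewrite (le_lt_trans (ler_normD _ _))// [e]splitr ler_ltD//.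
  rewrite normrZ; apply: (@le_trans _ _ ((`|a| + 1) * `|u - w|)).
    by rewrite ler_wpM2r// lerDl.
  by rewrite mulrC -ler_pdivlMr// ltW.
rewrite normrZ; apply: (@le_lt_trans _ _ (`|a - ratr q| * (`|w| + 1))).
  by rewrite ler_wpM2l// lerDl.
by rewrite -ltr_pdivlMr.
Qed.

Lemma closure_rat_span_sum (I : Type) (s : seq I) (c : I -> R) (F : I -> linf R) :
  (forall i, closure rat_span (F i)) ->
  closure rat_span (\sum_(i <- s) c i *: F i).
Proof.
move=> FD; elim: s => [|i s IH].
  rewrite big_nil; apply: subset_closure; exists [::]; first by [].
  by rewrite big_nil.
by rewrite big_cons; apply: closure_rat_spanD => //; exact: closure_rat_spanZ.
Qed.

Lemma closure_trans (D S : set (linf R)) :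
  D `<=` closure S -> closure D `<=` closure S.
Proof.
move=> DS; have -> := (closure_id _).1 (@closed_closure _ S).
exact: closure_subset.
Qed.

(** A null sequence is the limit of its truncations. These have real coefficients and lie only in
    the closure of [rat_span], hence the double closure. *)
Lemma c0_closure_rat_span : @c0 R `<=` closure rat_span.
Proof.
move=> f /c0P f0.
suff : closure (closure rat_span) f by apply: closure_trans.
apply/closure_normP => e e0.
have [N NP] := f0 (e / 2) (divr_gt0 e0 (ltr0n _ 2)).
exists (\sum_(i < N) f i *: unit_vec i).
  apply: closure_rat_span_sum => i; apply: subset_closure; apply: rat_span_gens.
  by left; exists (nat_of_ord i).
apply: (@le_lt_trans _ _ (e / 2)); last by rewrite ltr_pdivrMr// mulr_natr mulr2n ltrDl.
apply: linf_norm_le => n.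
have -> : (f - \sum_(i < N) f i *: unit_vec i) n =
    f n - \sum_(i < N) f i * (i == n :> nat)%:R.
  transitivity (f n - (\sum_(i < N) f i *: unit_vec i) n); first by [].
  rewrite linf_sum_coord; congr (_ - _); apply: eq_bigr => i _.
  transitivity (f i * unit_vec i n); first by [].
  rewrite linf_indicE eq_sym; congr (_ * (nat_of_bool _)%:R).
  by apply/idP/eqP => [/set_mem|->]; rewrite ?inE.
have [Nn|nN] := leqP N n.
  rewrite big1 ?subr0; first exact: NP.
  by move=> i _; rewrite ltn_eqF ?mulr0// (leq_trans _ Nn).
rewrite (bigD1 (Ordinal nN))//= eqxx mulr1 big1 ?addr0 ?subrr ?normr0 ?divr_ge0 ?ltW//.
by move=> i; rewrite -val_eqE /= => /negPf->; rewrite mulr0.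
Qed.

Lemma rat_span_dense : dense_in E rat_span.
Proof.
split; first exact: rat_span_sub.
apply: closure_trans => _ [n [a [v [vS ->]]]].
apply: closure_rat_span_sum => i; have [/c0_closure_rat_span//|vA] := vS i.
by apply: subset_closure; apply: rat_span_gens; right.
Qed.

(* [null_along B] is the kernel of the coordinate functional of [B] on the
   quotient of the generated space by [c_0]. *)
Definition null_along (B : set nat) : set (linf R) := [set v | forall e : R,
  0 < e -> exists N, forall n, (N <= n)%N -> B n -> `|v n| <= e].

Lemma null_along_closure B S : S `<=` null_along B ->
  closure S `<=` null_along B.
Proof.
move=> SB v /closure_normP Sv e e0.
have e20 : 0 < e / 2 by rewrite divr_gt0.
have [u Su vu] := Sv _ e20; have [N NP] := SB _ Su _ e20.
exists N => n Nn Bn; rewrite -[v n](subrK (u n)) [e]splitr.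
apply: le_trans (ler_normD _ _) (lerD _ (NP _ Nn Bn)).
exact: le_trans (linf_coord_le (v - u) n) (ltW vu).
Qed.

Lemma null_along_span B S : S `<=` null_along B ->
  linear_span S `<=` null_along B.
Proof.
move=> SB _ [k [c [v [vS ->]]]].
elim: (index_enum _) => [|i s IH] e e0.
  exists 0%N => n _ _; rewrite big_nil (_ : (0 : linf R) n = 0)// normr0.
  exact: ltW.
have e20 : 0 < e / 2 by rewrite divr_gt0.
have c0' : 0 < `|c i| + 1 by rewrite ltr_wpDl.
have [N NP] := IH _ e20; have [N' NP'] := SB _ (vS i) _ (divr_gt0 e20 c0').
exists (maxn N N') => n; rewrite geq_max => /andP[Nn N'n] Bn.
rewrite big_cons [e]splitr.
apply: (le_trans (ler_normD (c i * v i n) ((\sum_(j <- s) c j *: v j) n))).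
apply: lerD; last exact: NP.
rewrite normrM; apply: (@le_trans _ _ ((`|c i| + 1) * `|v i n|)).
  by rewrite ler_wpM2r// lerDl.
by rewrite mulrC -ler_pdivlMr//; exact: NP'.
Qed.

Lemma c0_null_along B : @c0 R `<=` null_along B.
Proof. by move=> f /c0P f0 e /f0[N NP]; exists N => n /NP. Qed.

Context (AD : almost_disjoint_family A).

(** Beyond the maximum of the finite intersection, the indicator of [C] vanishes along [B]. *)
Lemma indic_null_along B C : A B -> A C -> C <> B ->
  null_along B (linf_indic R C).
Proof.
move=> AB AC CB e e0; have [_ /(_ _ _ AC AB CB)/finite_seqP[s sE]] := AD.
exists (\max_(n <- s) n).+1 => n sn Bn; rewrite linf_indicE memNset ?normr0 ?ltW//.
move=> Cn; have ns : n \in s.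
  by have : (C `&` B) n by []; rewrite sE.
have := @leq_bigmax_seq _ s xpredT id n ns isT.
by rewrite leqNgt sn.
Qed.

Lemma indic_not_null_along B : A B -> ~ null_along B (linf_indic R B).
Proof.
move=> AB nB; have [Binf _] := AD; apply: (Binf _ AB).
have [|N NP] := nB (1 / 2); first by rewrite divr_gt0.
apply: (sub_finite_set _ (finite_II N)) => n Bn /=.
rewrite ltnNge; apply/negP => /NP/(_ Bn); rewrite linf_indicE mem_set// normr1.
by apply/negP; rewrite -ltNge ltr_pdivrMr// mul1r ltr1n.
Qed.

(** A finite combination within [1 / (2(k + 1))] of [v] involves finitely many indicators. Along
    every other member of [A], [v] is eventually at most [1 / (k + 1)]; the exceptions for all [k]
    together are countably many. *)
Lemma countable_support v : E v ->
  countable [set B | A B /\ ~ null_along B v].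
Proof.
move=> /closure_normP Ev.
have /choice[F FP] : forall k : nat, exists F : set (set nat), finite_set F /\
    forall B, A B -> ~ F B -> exists N, forall n, (N <= n)%N -> B n ->
      `|v n| <= k.+1%:R^-1.
  move=> k; have k20 : 0 < (k.+1%:R^-1 / 2 : R) by rewrite divr_gt0 ?invr_gt0.
  have [_ [p [c [w [wS ->]]]] vu] := Ev _ k20.
  (* Terms in [c0] may get the default [set0], which at most enlarges the finite set [range C]. *)
  have /choice[C CP] : forall i, exists C, ~ @c0 R (w i) -> A C /\ linf_indic R C = w i.
    by move=> i; have [?|[C AC <-]] := wS i; [exists set0|exists C].
  exists (range C); split; first exact: finite_image.
  move=> B AB nCB.
  have wB : [set w i | i in [set: 'I_p]] `<=` null_along B.
    move=> _ [i _ <-]; have [/c0_null_along//|nc0] := pselect (@c0 R (w i)).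
    have [AC <-] := CP _ nc0; apply: indic_null_along => // CB.
    by apply: nCB; exists i.
  have [|N NP] := null_along_span wB (t := \sum_(i < p) c i *: w i) _ k20.
    by exists p, c, w; split=> // i; exists i.
  exists N => n Nn Bn; set u := \sum_(i < p) _ in vu NP.
  rewrite -[v n](subrK (u n)) [_^-1]splitr.
  apply: le_trans (ler_normD _ _) (lerD _ (NP _ Nn Bn)).
  exact: le_trans (linf_coord_le (v - u) n) (ltW vu).
apply: (@sub_countable _ _ _ (\bigcup_k F k)); last first.
  by apply: bigcup_countable => // k _; apply: finite_set_countable; have [] := FP k.
apply: subset_card_le => B [AB nB]; apply: contrapT => nF; apply: nB => e e0.
have [k] := ltr_add_invr e0; rewrite add0r => ke.
have [_ /(_ B AB)[|N NP]] := FP k; first by move=> FkB; apply: nF; exists k.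
by exists N => n Nn Bn; exact: le_trans (NP _ Nn Bn) (ltW ke).
Qed.

(** Otherwise each [B] in [A] lies in the support of some element of [S], since else the whole space
    would be null along [B]. Supports are countable, so [A] would be countable or embed in [S]. *)
Lemma closure_span_not_onto (S Y : set (linf R)) :
  ~ countable A -> ~ (A #<= S) -> S `<=` E -> linearly_dense_in E Y ->
  exists2 y, Y y & ~ closure (linear_span (unit_vec 0 |` S)) y.
Proof.
move=> nA nAS SE [_ EY]; apply: contrapT => none.
have YS : Y `<=` closure (linear_span (unit_vec 0 |` S)).
  by move=> y Yy; apply: contrapT => ny; apply: none; exists y.
have AE : A `<=` \bigcup_(v in S) [set B | A B /\ ~ null_along B v].
  move=> B AB; apply: contrapT => nB; apply: (indic_not_null_along AB).
  have SB : unit_vec 0 |` S `<=` null_along B.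
    move=> v [->|Sv]; first exact/c0_null_along/unit_vec_c0.
    by apply: contrapT => nv; apply: nB; exists v.
  suff EB : E `<=` null_along B.
    by apply: EB; apply: sub_generated_space; right; exists B.
  move=> v /EY; apply: null_along_closure; apply: null_along_span => y /YS.
  by apply: null_along_closure; exact: null_along_span.
have [Sfin|Sinf] := pselect (finite_set S).
  apply: nA; apply: sub_countable (subset_card_le AE) _.
  apply: bigcup_countable; first exact: finite_set_countable.
  by move=> v /SE; exact: countable_support.
apply: nAS; apply: card_le_trans (subset_card_le AE) _.
apply: (bigcup_card_le Sinf) => // v /SE/countable_support; exact: (countable_card_le Sinf).
Qed.

End GeneratedSpace.

(** * Transfinite recursion inside an overcomplete set, and the contradiction *)

Theorem corollary21 (R : realType) (A : set (set nat))
    (MA : martin_axiom R) (notCH : ~ continuum_hypothesis R)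
    (AD : almost_disjoint_family A)
    (card_A : card_lt A [set: R])
    (cof_A : uncountable_cofinality A) :
  ~ exists Y : set (linf R), overcomplete_in (generated_space R A) Y.
Proof.
move=> [Y [YE [_ Ydens] Yover]].
have nA := uncountable_cofinality_uncountable cof_A.
have Ainf := uncountable_infinite nA.
(* The rational span bounds the density character by |A|. *)
have YA : Y #<= A.
  exact: card_le_trans (Ydens _ (rat_span_dense R A)) (rat_span_card R Ainf).
have Yspan : linearly_dense_in (generated_space R A) Y by exact: Yover.
have [r [Awo Ainit] _] := cof_A.
pose x := linf_indic R [set 0%N].
(* The step may be given any set [S], so it uses only the part in [Y]; earlier values do lie in [Y],
   and [gfar] removes the restriction. *)
have [g gE] := wo_rec Awo (fun _ S =>
  xget 0 [set y | Y y /\ ~ closure (linear_span (x |` (S `&` Y))) y]).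
have gP a : A a -> Y (g a) /\
    ~ closure (linear_span (x |` (g @` init_seg A r a `&` Y))) (g a).
  move=> Aa; rewrite gE//.
  have [| |y Yy ny] := @closure_span_not_onto R A AD
      (g @` init_seg A r a `&` Y) Y nA _ _ Yspan.
  (* The well-order is initial, so fewer than |A| values precede [a]. *)
  - move=> AS; have [_] := Ainit _ Aa; apply; apply: card_le_trans AS _.
    apply: card_le_trans (card_image_le g _).
    by apply: subset_card_le; exact: subIsetl.
  - by move=> y [_ /YE].
  set P := [set y | _ /\ _]; suff : P (xget 0 P) by [].
  by apply: xgetPex; exists y; split.
have x0 : x != 0.
  apply/eqP => x0; have := linf_indicE R [set 0%N] 0%N; rewrite -/x x0 mem_set//.
  by move=> /eqP; rewrite eq_sym oner_eq0.
have gfar a : A a ->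
    ~ closure (linear_span (x |` (g @` init_seg A r a))) (g a).
  move=> Aa; have [_] := gP _ Aa.
  suff -> : g @` init_seg A r a `&` Y = g @` init_seg A r a by [].
  by apply/setIidPl => _ [b [Ab _ _] <-]; have [] := gP _ Ab.
have [Z [ZA AZ xZ]] := martin_axiom_not_dense MA card_A cof_A Awo x0 gfar.
have gZY : g @` Z `<=` Y by move=> _ [a /ZA Aa <-]; have [] := gP _ Aa.
(* The selected values are as many as [Y], so overcompleteness makes their span dense, which
   contradicts [xZ]. *)
have [|_ EZ] := Yover _ gZY.
  apply: Cantor_Bernstein; first exact: subset_card_le.
  exact: card_le_trans YA AZ.
by apply: xZ; apply: EZ; apply: sub_generated_space; left; exact: unit_vec_c0.
Qed.
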